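(* Let $\mathcal{H}$ be a separable real or complex Hilbert space and let $T$ be a bounded invertible operator on $\mathcal{H}$. Then the ellipsoidal surface $\mathcal{E}_T$ contains a tight frame for $\mathcal{H}$. Moreover: (i) If $\dim\mathcal{H}=n<\infty$, then for every integer $k\ge n$, $\mathcal{E}_T$ contains a tight frame of length $k$, and every tight frame of length $k$ contained in $\mathcal{E}_T$ has frame bound $K=k\,[\operatorname{trace}(T^{-2})]^{-1}$ (here $T$ is taken positive; see context). (ii) If $\dim\mathcal{H}=\infty$ and $T$ is positive, then for every constant $K>1/\|T^{-2}\|_{ess}$, $\mathcal{E}_T$ contains a tight frame with frame bound $K$.
   Context: A sequence $\{x_j\}_{j\in J}$ in $\mathcal{H}$ is a frame if there are constants $0<A\le B$ with $A\|x\|^2\le\sum_j|\langle x,x_j\rangle|^2\le B\|x\|^2$ for all $x\in\mathcal{H}$; it is tight if $A=B$, and this common value is the frame bound. The length of a frame is the number of its vectors (counted as a sequence). For a bounded invertible $T$, $\mathcal{E}_T=T\mathcal{S}_1$ where $\mathcal{S}_1=\{x\in\mathcal{H}:\|x\|=1\}$ is the unit sphere. Every such surface equals $\mathcal{E}_T$ for a unique positive invertible $T$ (namely $|T^*|=(TT^* )^{1/2}$), and statements involving $T^{-2}$ refer to this positive $T$. The essential norm is $\|B\|_{ess}=\inf\{\|B-K\|: K\text{ compact}\}$. *)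

(* Defs.v *)
From HB Require Import structures.
From mathcomp Require Import all_boot all_order all_algebra.
From mathcomp Require Import all_classical all_reals.
From mathcomp Require Import ereal esum.
From mathcomp Require complex.

Set Implicit Arguments.
Unset Strict Implicit.
Unset Printing Implicit Defensive.

Import Order.TTheory GRing.Theory Num.Theory.
Local Open Scope classical_set_scope.
Local Open Scope ring_scope.

Section Hilbert.
(* R : the real numbers; K : the scalar field (R or C = R[i]) equipped with
   its conjugation, real part and the embedding R -> K. *)
Variables (R : realType) (K : fieldType)
  (conj : K -> K) (re : K -> R) (ofR : R -> K).
Variables (V : lmodType K) (ip : V -> V -> K).

Definition nrm2 (x : V) : R := re (ip x x).
Definition nrm (x : V) : R := Num.sqrt (nrm2 x).
Definition abs2 (z : K) : R := re (z * conj z).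

Definition is_inner_product : Prop :=
  [/\ (forall a x y z, ip (a *: x + y) z = a * ip x z + ip y z),
      (forall x y, ip y x = conj (ip x y)),
      (forall x, ip x x = ofR (nrm2 x)),
      (forall x, 0 <= nrm2 x) &
      (forall x, nrm2 x = 0 -> x = 0)].

Definition converges (u : nat -> V) (l : V) : Prop :=
  forall e : R, 0 < e -> exists N, forall n, (N <= n)%N -> nrm (u n - l) < e.

Definition cauchy_seq (u : nat -> V) : Prop :=
  forall e : R, 0 < e -> exists N, forall m n, (N <= m)%N -> (N <= n)%N ->
    nrm (u m - u n) < e.

Definition complete_space : Prop :=
  forall u, cauchy_seq u -> exists l, converges u l.

Definition separable_space : Prop :=
  exists d : nat -> V, forall x (e : R), 0 < e -> exists n, nrm (x - d n) < e.

Definition is_separable_hilbert : Prop :=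
  [/\ is_inner_product, complete_space & separable_space].

Definition has_dim (n : nat) : Prop :=
  exists b : 'I_n -> V,
    (forall c : 'I_n -> K, \sum_(i < n) c i *: b i = 0 -> forall i, c i = 0) /\
    (forall x, exists c : 'I_n -> K, x = \sum_(i < n) c i *: b i).

Definition finite_dim : Prop := exists n, has_dim n.

Definition linear_op (T : V -> V) : Prop :=
  forall a x y, T (a *: x + y) = a *: T x + T y.

Definition bounded_op (T : V -> V) : Prop :=
  linear_op T /\ exists M : R, forall x, nrm (T x) <= M * nrm x.

Definition inverse_op (T S : V -> V) : Prop :=
  [/\ bounded_op S, cancel T S & cancel S T].

Definition invertible_op (T : V -> V) : Prop :=
  bounded_op T /\ exists S, inverse_op T S.

Definition positive_op (T : V -> V) : Prop :=
  [/\ bounded_op T, (forall x y, ip (T x) y = ip x (T y)) &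
      (forall x, 0 <= re (ip (T x) x))].

Definition ellipsoid (T : V -> V) : set V :=
  T @` [set x | nrm x = 1].

Definition frame_sum (J : choiceType) (f : J -> V) (x : V) : \bar R :=
  \esum_(j in [set: J]) (abs2 (ip x (f j)))%:E.

Definition is_frame (J : choiceType) (f : J -> V) (A B : R) : Prop :=
  [/\ 0 < A, A <= B &
      forall x, ((A * nrm2 x)%:E <= frame_sum f x)%E /\
                (frame_sum f x <= (B * nrm2 x)%:E)%E].

Definition tight_frame (J : choiceType) (f : J -> V) (A : R) : Prop :=
  is_frame f A A.

Definition opnorm (T : V -> V) : R :=
  sup [set nrm (T x) | x in [set x | nrm x <= 1]].

Definition compact_op (C : V -> V) : Prop :=
  linear_op C /\
  forall u : nat -> V, (forall n, nrm (u n) <= 1) ->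
    exists phi : nat -> nat, (forall n, (phi n < phi n.+1)%N) /\
      exists l, converges (fun n => C (u (phi n))) l.

Definition ess_norm (B : V -> V) : R :=
  inf [set opnorm (fun x => B x - C x) | C in compact_op].

Definition onb (n : nat) (e : 'I_n -> V) : Prop :=
  (forall i j, ip (e i) (e j) = (i == j)%:R) /\
  (forall x, exists c : 'I_n -> K, x = \sum_(i < n) c i *: e i).

Definition trace_wrt (n : nat) (e : 'I_n -> V) (B : V -> V) : K :=
  \sum_(i < n) ip (B (e i)) (e i).

End Hilbert.

Definition theorem3_for (R : realType) (K : fieldType)
  (conj : K -> K) (re : K -> R) (ofR : R -> K) : Prop :=
  forall (V : lmodType K) (ip : V -> V -> K),
  is_separable_hilbert conj re ofR ip ->
  forall T : V -> V, invertible_op re ip T ->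
  (exists (J : choiceType) (f : J -> V) (A : R),
      (forall j, ellipsoid re ip T (f j)) /\ tight_frame conj re ip f A) /\
  (forall n : nat, (0 < n)%N -> has_dim V n ->
     (forall k : nat, (n <= k)%N ->
        exists (f : 'I_k -> V) (A : R),
          (forall j, ellipsoid re ip T (f j)) /\ tight_frame conj re ip f A) /\
     (forall P S : V -> V, positive_op re ip P -> inverse_op re ip P S ->
        ellipsoid re ip P = ellipsoid re ip T ->
        forall k : nat, (n <= k)%N ->
        forall (f : 'I_k -> V) (A : R),
          (forall j, ellipsoid re ip T (f j)) -> tight_frame conj re ip f A ->
          forall e : 'I_n -> V, onb ip e ->
            A = k%:R / re (trace_wrt ip e (fun x => S (S x))))) /\
  (~ finite_dim V -> positive_op re ip T ->
     forall S : V -> V, inverse_op re ip T S ->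
     forall Kb : R, 1 / ess_norm re ip (fun x => S (S x)) < Kb ->
       exists (J : choiceType) (f : J -> V),
         (forall j, ellipsoid re ip T (f j)) /\ tight_frame conj re ip f Kb).

(* Main.v *)
Require Import Defs.
From HB Require Import structures.
From mathcomp Require Import all_boot all_order all_algebra.
From mathcomp Require Import all_classical all_reals.
From mathcomp Require Import ereal esum topology normedtype sequences.
From mathcomp Require Import ring lra.

(* The ellipsoid is the level set q = 1 of the quadratic form q y = |T^-1 y|^2.
   Replacing two vectors x, y by c x + s y, c y - s x with c^2 + s^2 = 1 changes
   neither the frame operator of the pair nor q x + q y, and if q x <= 1 <= q y
   an angle can be chosen so that one of the new vectors lies on the ellipsoid.

   In dimension n, scale an orthonormal basis so that its q-values add up to k,
   pad with k - n zero vectors, and rotate until every q-value is 1.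

   In infinite dimension, take sqrt K times an orthonormal basis made of blocks
   whose average q-value exceeds 1 + d, and equalize q inside each block.  Then
   run through the sequence with a leftover z, q z < 1: rotate z with the next
   vector, output the vector that lands on the ellipsoid, and peel off the other
   one (again a multiple on the ellipsoid) the integral part of its q-value.
   Each rotation contracts <v, z> by a fixed factor, so the leftovers tend
   weakly to 0 and the output is a tight frame.  For T positive and
   K ||T^-2||_ess > 1, blocks of this kind exist: if q were < (1 + d) / K on the
   unit sphere of the complement of a finite-dimensional subspace, then
   compressing T^-2 to it, a finite-rank perturbation, would have norm at most
   (1 + d) / K. *)
Set Implicit Arguments.
Unset Strict Implicit.
Unset Printing Implicit Defensive.

Import Order.TTheory GRing.Theory Num.Theory.
Import numFieldNormedType.Exports.
From mathcomp Require Import complex.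

(** * Real estimates: the rotation angle and a contraction recurrence *)

Section RealFacts.
Local Open Scope ring_scope.
Variable R : realType.

(** Dividing by [c ^+ 2] and setting [u = s / c] turns the equation into
    [(Y - a) u^2 + 2 u t = a - X], which has a root [u >= 0] when [X <= a < Y]. The final bound
    holds because the other two terms of the sum equal to [a] are nonnegative; it later makes the
    leftovers contract. *)
Lemma rotation_exists (X Y t a : R) : 0 <= X -> X <= a -> a <= Y -> 0 <= t ->
  exists c s : R, [/\ 0 <= c, 0 <= s, c ^+ 2 + s ^+ 2 = 1,
    c ^+ 2 * X + s ^+ 2 * Y + 2 * (c * s) * t = a & s ^+ 2 * Y <= a].
Proof.
move=> X0 Xa aY t0.
(* For [Y = a] the quadratic in [u] loses its leading term; the quarter turn [c = 0], [s = 1] serves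
   instead. *)
have [Ya|Ya] := eqVneq Y a.
  exists 0, 1; rewrite -Ya expr0n expr1n.
  by rewrite !mul0r !mulr0 !mul1r mul0r !addr0 !add0r.
have {Ya}lt_aY : a < Y by rewrite lt_neqAle eq_sym Ya.
have Ya0 : Y - a != 0 by rewrite subr_eq0 gt_eqF.
have prod0 : 0 <= (Y - a) * (a - X) by rewrite mulr_ge0 // subr_ge0 // ltW.
pose r := Num.sqrt (t ^+ 2 + (Y - a) * (a - X)).
have D0 : 0 <= t ^+ 2 + (Y - a) * (a - X).
  by rewrite addr_ge0 ?sqr_ge0.
have r2 : r ^+ 2 = t ^+ 2 + (Y - a) * (a - X) by rewrite sqr_sqrtr.
have tr : t <= r.
  by rewrite -(ger0_norm t0) -sqrtr_sqr ler_wsqrtr // lerDl.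
pose u := (r - t) / (Y - a).
have u0 : 0 <= u by rewrite divr_ge0 ?subr_ge0 // ltW.
have uE : (Y - a) * u ^+ 2 + 2 * u * t = a - X.
  have -> : (Y - a) * u ^+ 2 + 2 * u * t = (r ^+ 2 - t ^+ 2) / (Y - a).
    by rewrite /u; field.
  by rewrite r2; field.
have n0 : 0 < 1 + u ^+ 2 by rewrite ltr_pwDl // sqr_ge0.
pose c := (Num.sqrt (1 + u ^+ 2))^-1.
have c0 : 0 <= c by rewrite invr_ge0 sqrtr_ge0.
have c2 : c ^+ 2 * (1 + u ^+ 2) = 1.
  by rewrite exprVn sqr_sqrtr ?ltW // mulVf // gt_eqF.
have eqa : c ^+ 2 * X + (u * c) ^+ 2 * Y + 2 * (c * (u * c)) * t = a.
  transitivity (c ^+ 2 * (1 + u ^+ 2) * a); last by rewrite c2 mul1r.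
  transitivity (c ^+ 2 * (X + (u ^+ 2 * Y + 2 * u * t))); first by ring.
  by have -> : X = a - ((Y - a) * u ^+ 2 + 2 * u * t); [rewrite uE; ring|ring].
exists c, (u * c); split=> //; first exact: mulr_ge0.
- by rewrite -c2; ring.
- have cu0 : 0 <= 2 * (c * (u * c)) * t.
    by rewrite mulr_ge0 // mulr_ge0 // mulr_ge0 // mulr_ge0.
  have cX0 : 0 <= c ^+ 2 * X by rewrite mulr_ge0 // sqr_ge0.
  by rewrite -[leRHS]eqa; lra.
Qed.

(** Summing the recurrence gives [(1 - th) * sum a_i <= a_0 + C * B], so [a] cannot stay above [e]
    from index [M] on. *)
Lemma contraction_vanishes (th C : R) (a b : nat -> R) (B : R) :
    0 <= th -> th < 1 -> 0 <= C -> (forall n, 0 <= a n) ->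
    (forall n, a n.+1 <= th * a n + C * b n) ->
    (forall n, \sum_(i < n) b i <= B) ->
  forall (e : R) (M : nat), 0 < e -> exists2 m, (M <= m)%N & a m < e.
Proof.
move=> th0 th1 C0 a0 aS bB e M e0.
have sumS n : (1 - th) * \sum_(i < n) a i <= a 0%N + C * B.
  have sumS' : \sum_(i < n) a i.+1 <= th * \sum_(i < n) a i + C * B.
    apply: (@le_trans _ _ (\sum_(i < n) (th * a i + C * b i))).
      exact: ler_sum.
    rewrite big_split /= -mulr_sumr -mulr_sumr lerD2l.
    by apply: ler_wpM2l (bB n).
  have shift : \sum_(i < n) a i.+1 + a 0%N = \sum_(i < n) a i + a n.
    elim: n {sumS'} => [|n IH]; first by rewrite !big_ord0.
    by rewrite !big_ord_recr /= addrAC IH addrAC.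
  have := a0 n; by move: sumS' shift; lra.
apply: contrapT => nex.
have ge_e m : (M <= m)%N -> e <= a m.
  by move=> Mm; rewrite leNgt; apply/negP => am; apply: nex; exists m.
have B0 : 0 < (1 - th) * e by rewrite mulr_gt0 // subr_gt0.
(* With this many terms of size at least [e], the bound [sumS] is violated. *)
pose n := (Num.truncn ((a 0%N + C * B) / ((1 - th) * e))).+1.
have ltn : a 0%N + C * B < (1 - th) * e * n%:R.
  by rewrite [ltRHS]mulrC -ltr_pdivrMr //; exact: truncnS_gt.
have := sumS (M + n)%N; apply/negP; rewrite -ltNge; apply: (lt_le_trans ltn).
rewrite -mulrA ler_pM2l ?subr_gt0 // big_split_ord /= -[leLHS]add0r.
rewrite lerD ?sumr_ge0 //.
rewrite mulr_natr -[n in _ *+ n]card_ord -sumr_const; apply: ler_sum => i _.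
by apply: ge_e; rewrite leq_addr.
Qed.

End RealFacts.

(** * Scalars: axioms shared by the real and the complex field *)

Section Scalars.
Local Open Scope ring_scope.
Variables (R : realType) (K : fieldType).
Variables (conj : K -> K) (re : K -> R) (ofR : R -> K).

(* The common properties of R and C from which both cases are proved at once. *)
Record scalar_field : Prop := ScalarField {
  reD : {morph re : x y / x + y};
  re_ofRM : forall a z, re (ofR a * z) = a * re z;
  re_conj : forall z, re (conj z) = re z;
  re1 : re 1 = 1;
  conjD : {morph conj : x y / x + y};
  conjM : {morph conj : x y / x * y};
  conjK : involutive conj;
  conj_ofR : forall a, conj (ofR a) = ofR a;
  ofRM : {morph ofR : a b / a * b};
  ofR1 : ofR 1 = 1;
  mul_conj : forall z, z * conj z = ofR (abs2 conj re z);
  abs2_ge0 : forall z, 0 <= abs2 conj re z;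
  scalar_bolzano_weierstrass : forall (u : nat -> K) (M : R),
    (forall n, abs2 conj re (u n) <= M) ->
    exists2 phi : nat -> nat, (forall n, (phi n < phi n.+1)%N) &
      exists l, forall e, 0 < e -> exists N, forall n, (N <= n)%N ->
        abs2 conj re (u (phi n) - l) < e
}.

End Scalars.

Section ScalarInstances.
Local Open Scope ring_scope.
Variable R : realType.

Lemma real_bolzano_weierstrass (u : nat -> R) (M : R) :
    (forall n, `|u n| <= M) ->
  exists2 phi : nat -> nat, (forall n, (phi n < phi n.+1)%N) &
    exists l, forall e, 0 < e -> exists N, forall n, (N <= n)%N ->
      `|u (phi n) - l| < e.
Proof.
move=> uM; have [|phi incr /cvg_ex[l /cvgrPdist_lt ul]] :=
  bolzano_weierstrass (u_ := u).
  exists M; split; first exact: num_real.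
  by move=> x Mx n _ /=; apply: le_trans (uM n) (ltW Mx).
exists phi.
  move=> n; have E : (phi n.+1 <= phi n)%N = (n.+1 <= n)%N := incr n.+1 n.
  by rewrite ltnNge E ltnn.
exists l => e /ul [N _ uN]; exists N => n Nn.
by rewrite distrC; exact: uN.
Qed.

Lemma real_scalar_field : scalar_field (K := R) id id id.
Proof.
split=> //; first by move=> z; rewrite /abs2 -expr2 sqr_ge0.
(* [|u n|^2 <= M] implies [|u n| <= 1 + M]. *)
move=> u M uM; have [n|phi incr [l ul]] := @real_bolzano_weierstrass u (1 + M).
  have := uM n; rewrite /abs2 -expr2 -real_normK ?num_real //.
  by have := normr_ge0 (u n); nra.
exists phi => //; exists l => e e0.
have [|N uN] := ul (Num.sqrt e); first by rewrite sqrtr_gt0.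
exists N => n /uN; rewrite /abs2 -expr2 -real_normK ?num_real // => lt.
by rewrite -[ltRHS]sqr_sqrtr ?ltW // ltr_pXn2r ?nnegrE ?sqrtr_ge0.
Qed.

Lemma abs2_complex (z : R[i]) :
  abs2 (@conjc R) (@Re R) z = Re z ^+ 2 + Im z ^+ 2.
Proof. by case: z => a b; rewrite /abs2 /=; ring. Qed.

Lemma subseq_mono (phi : nat -> nat) : (forall n, (phi n < phi n.+1)%N) ->
  forall n, (n <= phi n)%N.
Proof. by move=> incr; elim=> // n IH; apply: leq_ltn_trans IH (incr n). Qed.

Lemma subseq_comp (phi psi : nat -> nat) :
    (forall n, (phi n < phi n.+1)%N) -> (forall n, (psi n < psi n.+1)%N) ->
  forall n, (phi (psi n) < phi (psi n.+1))%N.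
Proof.
by move=> incr incr' n; apply: (homo_ltn ltn_trans incr).
Qed.

Lemma complex_scalar_field :
  scalar_field (@conjc R) (@Re R) (fun r => Complex r 0).
Proof.
split.
- by case=> a b [c d].
- by move=> a [b c] /=; rewrite mul0r subr0.
- by case.
- by [].
- by case=> a b [c d] /=; rewrite opprD.
- by case=> a b [c d]; apply/eqP; rewrite eq_complex /=;
    apply/andP; split; apply/eqP; ring.
- exact: conjcK.
- by move=> a /=; rewrite oppr0.
- by move=> a b; apply/eqP; rewrite eq_complex /=;
    apply/andP; split; apply/eqP; ring.
- by [].
- by case=> a b; apply/eqP; rewrite eq_complex /abs2 /=;
    apply/andP; split; apply/eqP; ring.
- by move=> z; rewrite abs2_complex addr_ge0 ?sqr_ge0.
move=> u M uM.
have bnd (a : R) : a ^+ 2 <= M -> `|a| <= 1 + M.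
  by rewrite -real_normK ?num_real //; have := normr_ge0 a; nra.
have [n|phi incr [l ul]] :=
    @real_bolzano_weierstrass (fun n => Re (u n)) (1 + M).
  by apply: bnd; apply: le_trans (uM n); rewrite abs2_complex lerDl sqr_ge0.
(* The subsequence found for the real parts is thinned out again for the imaginary parts. *)
have [n|psi incr' [m um]] :=
    @real_bolzano_weierstrass (fun n => Im (u (phi n))) (1 + M).
  apply: bnd; apply: le_trans (uM (phi n)).
  by rewrite abs2_complex lerDr sqr_ge0.
exists (phi \o psi); first by move=> n; exact: (subseq_comp incr incr' n).
exists (Complex l m) => e e0.
have s0 : 0 < Num.sqrt (e / 2) by rewrite sqrtr_gt0 divr_gt0.
have lt2 (a : R) : `|a| < Num.sqrt (e / 2) -> a ^+ 2 < e / 2.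
  move=> lt; rewrite -real_normK ?num_real //.
  rewrite -[ltRHS]sqr_sqrtr ?divr_ge0 ?ltW //.
  by rewrite ltr_pXn2r ?nnegrE ?sqrtr_ge0.
have [N1 uN1] := ul _ s0; have [N2 uN2] := um _ s0.
exists (maxn N1 N2) => n; rewrite geq_max => /andP[le1 le2].
rewrite abs2_complex.
have /uN1/lt2 : (N1 <= psi n)%N by apply: leq_trans (subseq_mono incr' n).
have := lt2 _ (uN2 _ le2).
by rewrite /=; case: (u (phi (psi n))) => a b /=; lra.
Qed.

End ScalarInstances.

(** * Inner product calculus, linear maps and orthogonal projections *)

Section InnerProduct.
Local Open Scope ring_scope.
Variables (R : realType) (K : fieldType).
Variables (conj : K -> K) (re : K -> R) (ofR : R -> K).
Variables (V : lmodType K) (ip : V -> V -> K).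
Hypothesis HK : scalar_field conj re ofR.
Hypothesis HV : is_inner_product conj re ofR ip.

Local Notation N := (nrm2 re ip).
Local Notation norm := (nrm re ip).
Local Notation A := (abs2 conj re).

Lemma re0 : re 0 = 0.
Proof. by have := reD HK 0 0; rewrite addr0 => h; lra. Qed.

Lemma reN z : re (- z) = - re z.
Proof. by have := reD HK z (- z); rewrite subrr re0; lra. Qed.

Lemma re_sum (I : Type) (r : seq I) (F : I -> K) :
  re (\sum_(i <- r) F i) = \sum_(i <- r) re (F i).
Proof. exact: (big_morph re (reD HK) re0). Qed.

Lemma re_ofR a : re (ofR a) = a.
Proof. by rewrite -[ofR a]mulr1 (re_ofRM HK) (re1 HK) mulr1. Qed.

Lemma ofR0 : ofR 0 = 0.
Proof.
have : ofR 0 * (ofR 0 - 1) = 0 by rewrite mulrBr -(ofRM HK) mulr0 mulr1 subrr.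
move/eqP; rewrite mulf_eq0 => /orP[/eqP//|/eqP/subr0_eq h].
by have := re_ofR 0; rewrite h (re1 HK) => /eqP; rewrite oner_eq0.
Qed.

Lemma conj0 : conj 0 = 0.
Proof. by rewrite -ofR0 (conj_ofR HK). Qed.

Lemma conjN z : conj (- z) = - conj z.
Proof. by apply: (addrI (conj z)); rewrite -(conjD HK) !subrr conj0. Qed.

Lemma abs2M a b : A (a * b) = A a * A b.
Proof.
have : ofR (A (a * b)) = ofR (A a * A b).
  by rewrite (ofRM HK) -!(mul_conj HK) (conjM HK) mulrACA.
by move/(congr1 re); rewrite !re_ofR.
Qed.

Lemma abs2_ofR a : A (ofR a) = a ^+ 2.
Proof. by rewrite /abs2 (conj_ofR HK) (re_ofRM HK) re_ofR. Qed.

Lemma abs2N a : A (- a) = A a.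
Proof. by rewrite /abs2 conjN mulrNN. Qed.

Lemma abs2_conj a : A (conj a) = A a.
Proof. by rewrite /abs2 (conjK HK) mulrC. Qed.

Lemma abs2_0 : A 0 = 0.
Proof. by rewrite /abs2 mul0r re0. Qed.

Lemma abs2D a b : A (a + b) = A a + A b + 2 * re (a * conj b).
Proof.
rewrite /abs2 (conjD HK) mulrDl !mulrDr !(reD HK).
rewrite -[re (b * conj a)](re_conj HK) (conjM HK) (conjK HK) [conj b * a]mulrC.
ring.
Qed.

Lemma abs2_rotation c s a b :
  A (ofR c * a + ofR s * b) =
    c ^+ 2 * A a + s ^+ 2 * A b + 2 * (c * s) * re (a * conj b).
Proof.
rewrite abs2D !abs2M !abs2_ofR (conjM HK) (conj_ofR HK).
by rewrite mulrACA -(ofRM HK) (re_ofRM HK); ring.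
Qed.

(** Expanding [A (h a - b) >= 0] bounds the cross term. The weight [h] stays free so that [1 + h]
    can be taken close to 1. *)
Lemma abs2_leD h a b : 0 < h -> A (a + b) <= (1 + h) * A a + (1 + h^-1) * A b.
Proof.
move=> h0; rewrite abs2D.
have := abs2_ge0 HK (ofR h * a + ofR (- 1) * b); rewrite abs2_rotation => h1.
suff : 2 * re (a * conj b) <= (h ^+ 2 * A a + A b) / h.
  have -> : (h ^+ 2 * A a + A b) / h = h * A a + h^-1 * A b.
    by field; rewrite gt_eqF.
  lra.
by rewrite ler_pdivlMr //; lra.
Qed.

Lemma ipDZl a x y z : ip (a *: x + y) z = a * ip x z + ip y z.
Proof. by case: HV. Qed.

Lemma ipC x y : ip y x = conj (ip x y).
Proof. by case: HV. Qed.

Lemma ipxx x : ip x x = ofR (N x).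
Proof. by case: HV. Qed.

Lemma nrm2_ge0 x : 0 <= N x.
Proof. by case: HV. Qed.

Lemma nrm2_eq0 x : N x = 0 -> x = 0.
Proof. by case: HV => _ _ _ _; apply. Qed.

Lemma ipDl x y z : ip (x + y) z = ip x z + ip y z.
Proof. by have := ipDZl 1 x y z; rewrite scale1r mul1r. Qed.

Lemma ip0l z : ip 0 z = 0.
Proof. by apply: (addrI (ip 0 z)); rewrite -ipDl !addr0. Qed.

Lemma ipZl a x z : ip (a *: x) z = a * ip x z.
Proof. by have := ipDZl a x 0 z; rewrite addr0 ip0l addr0. Qed.

Lemma ipNl x z : ip (- x) z = - ip x z.
Proof. by rewrite -scaleN1r ipZl mulN1r. Qed.

Lemma ipBl x y z : ip (x - y) z = ip x z - ip y z.
Proof. by rewrite ipDl ipNl. Qed.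

Lemma ip_suml (I : Type) (r : seq I) (F : I -> V) z :
  ip (\sum_(i <- r) F i) z = \sum_(i <- r) ip (F i) z.
Proof. by apply: (big_morph (ip^~ z)) => [x y|]; rewrite ?ipDl ?ip0l. Qed.

Lemma ip0r z : ip z 0 = 0.
Proof. by rewrite ipC ip0l conj0. Qed.

Lemma ipDr z x y : ip z (x + y) = ip z x + ip z y.
Proof. by rewrite ipC ipDl (conjD HK) -!ipC. Qed.

Lemma ipZr a z x : ip z (a *: x) = conj a * ip z x.
Proof. by rewrite ipC ipZl (conjM HK) -ipC. Qed.

Lemma ipNr z x : ip z (- x) = - ip z x.
Proof. by rewrite ipC ipNl conjN -ipC. Qed.

Lemma ip_sumr (I : Type) (r : seq I) (F : I -> V) z :
  ip z (\sum_(i <- r) F i) = \sum_(i <- r) ip z (F i).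
Proof. by apply: (big_morph (ip z)) => [x y|]; rewrite ?ipDr ?ip0r. Qed.

Lemma re_ipC x y : re (ip y x) = re (ip x y).
Proof. by rewrite ipC (re_conj HK). Qed.

Lemma ip_eq0C x y : ip x y = 0 -> ip y x = 0.
Proof. by move=> h; rewrite ipC h conj0. Qed.

Lemma nrm2D x y : N (x + y) = N x + N y + 2 * re (ip x y).
Proof. by rewrite /nrm2 ipDl !ipDr !(reD HK) (re_ipC x y); ring. Qed.

Lemma nrm2Z a x : N (a *: x) = A a * N x.
Proof. by rewrite /nrm2 ipZl ipZr mulrA (mul_conj HK) (re_ofRM HK). Qed.

Lemma nrm2_ofRZ a x : N (ofR a *: x) = a ^+ 2 * N x.
Proof. by rewrite nrm2Z abs2_ofR. Qed.

Lemma nrm2N x : N (- x) = N x.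
Proof. by rewrite /nrm2 ipNl ipNr opprK. Qed.

Lemma nrm2_0 : N 0 = 0.
Proof. by rewrite /nrm2 ip0l re0. Qed.

Lemma nrm2_rotation c s x y :
  N (ofR c *: x + ofR s *: y) =
    c ^+ 2 * N x + s ^+ 2 * N y + 2 * (c * s) * re (ip x y).
Proof.
by rewrite nrm2D !nrm2_ofRZ ipZl ipZr (conj_ofR HK) !(re_ofRM HK); ring.
Qed.

Lemma cauchy_schwarz x y : re (ip x y) ^+ 2 <= N x * N y.
Proof.
have [/eqP/nrm2_eq0 ->|Ny] := boolP (N y == 0).
  by rewrite ip0r re0 nrm2_0 mulr0 expr0n.
have Ny0 : 0 < N y by rewrite lt_neqAle eq_sym Ny nrm2_ge0.
(* The squared norm of this vector is [N y * (N x * N y - re (ip x y) ^+ 2)]. *)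
have := nrm2_ge0 (ofR (N y) *: x + ofR (- re (ip x y)) *: y).
rewrite nrm2_rotation => h.
by rewrite -(ler_pM2l Ny0); lra.
Qed.

Lemma nrm_ge0 x : 0 <= norm x.
Proof. exact: sqrtr_ge0. Qed.

Lemma nrm_sqr x : norm x ^+ 2 = N x.
Proof. by rewrite sqr_sqrtr // nrm2_ge0. Qed.

Lemma nrm_leP x a : 0 <= a -> (norm x <= a) = (N x <= a ^+ 2).
Proof.
by move=> a0; rewrite -nrm_sqr ler_pXn2r ?nnegrE ?nrm_ge0.
Qed.

Lemma nrm_ltP x a : 0 <= a -> (norm x < a) = (N x < a ^+ 2).
Proof.
by move=> a0; rewrite -nrm_sqr ltr_pXn2r ?nnegrE ?nrm_ge0.
Qed.

Lemma nrm_eq1 x : norm x = 1 <-> N x = 1.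
Proof.
split=> [h|h]; first by rewrite -nrm_sqr h expr1n.
by rewrite /nrm h sqrtr1.
Qed.

Lemma re_ip_le x y : re (ip x y) <= norm x * norm y.
Proof.
have := cauchy_schwarz x y; rewrite -!nrm_sqr -exprMn => h.
rewrite (le_trans (ler_norm _)) // -sqrtr_sqr -[leRHS]ger0_norm.
  by rewrite -[leRHS]sqrtr_sqr ler_wsqrtr.
by rewrite mulr_ge0 ?nrm_ge0.
Qed.

Lemma nrmD x y : norm (x + y) <= norm x + norm y.
Proof.
rewrite nrm_leP ?addr_ge0 ?nrm_ge0 // nrm2D -!nrm_sqr.
by have := re_ip_le x y; lra.
Qed.

Lemma nrmN x : norm (- x) = norm x.
Proof. by rewrite /nrm nrm2N. Qed.

Lemma nrmBC x y : norm (x - y) = norm (y - x).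
Proof. by rewrite -nrmN opprB. Qed.

Lemma nrm_0 : norm 0 = 0.
Proof. by rewrite /nrm nrm2_0 sqrtr0. Qed.

Lemma nrmZ a x : norm (a *: x) = Num.sqrt (A a) * norm x.
Proof. by rewrite /nrm nrm2Z sqrtrM // (abs2_ge0 HK). Qed.

Section LinearMaps.
Variable S : V -> V.
Hypothesis linS : linear_op S.

Lemma linear_opD x y : S (x + y) = S x + S y.
Proof. by have := linS 1 x y; rewrite !scale1r. Qed.

Lemma linear_op0 : S 0 = 0.
Proof. by apply: (addrI (S 0)); rewrite -linear_opD !addr0. Qed.

Lemma linear_opZ a x : S (a *: x) = a *: S x.
Proof. by have := linS a x 0; rewrite linear_op0 !addr0. Qed.

Lemma linear_opN x : S (- x) = - S x.
Proof. by rewrite -scaleN1r linear_opZ scaleN1r. Qed.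

Lemma linear_opB x y : S (x - y) = S x - S y.
Proof. by rewrite linear_opD linear_opN. Qed.

Lemma linear_op_sum (I : Type) (r : seq I) (F : I -> V) :
  S (\sum_(i <- r) F i) = \sum_(i <- r) S (F i).
Proof. exact: (big_morph S linear_opD linear_op0). Qed.

End LinearMaps.

(* Orthonormal up to zero vectors: <e_i, e_i> e_i = e_i iff e_i is 0 or a unit
   vector.  This spares Gram-Schmidt the removal of dependent vectors. *)
Definition orthoid (e : nat -> V) (n : nat) : Prop :=
  (forall i j, (i < n)%N -> (j < n)%N -> i != j -> ip (e i) (e j) = 0) /\
  (forall i, (i < n)%N -> ip (e i) (e i) *: e i = e i).

Definition oproj (e : nat -> V) (n : nat) (x : V) : V :=
  \sum_(i < n) ip x (e i) *: e i.

Lemma orthoid_sub e m n : (m <= n)%N -> orthoid e n -> orthoid e m.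
Proof.
move=> mn [o1 o2]; split=> [i j im jm|i im].
  by apply: o1; [exact: leq_trans im mn|exact: leq_trans jm mn].
by apply: o2; exact: leq_trans im mn.
Qed.

Lemma oproj_linear e n : linear_op (oproj e n).
Proof.
move=> a x y; rewrite /oproj scaler_sumr -big_split /=; apply: eq_bigr => i _.
by rewrite ipDZl scalerDl scalerA.
Qed.

Section Orthoid.
Variables (e : nat -> V) (n : nat).
Hypothesis oe : orthoid e n.

Lemma ip_oproj x j : (j < n)%N -> ip (oproj e n x) (e j) = ip x (e j).
Proof.
move=> jn; rewrite ip_suml (bigD1 (Ordinal jn)) //= big1 => [|i ij].
  (* Rewriting [e j] as [<e_j, e_j> e_j] treats zero and unit vectors alike. *)
  by rewrite addr0 ipZl -[in RHS](oe.2 _ jn) ipZr -ipC mulrC.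
by rewrite ipZl oe.1 ?mulr0.
Qed.

Lemma ip_oproj0 x j : (j < n)%N -> ip (x - oproj e n x) (e j) = 0.
Proof. by move=> jn; rewrite ipBl ip_oproj // subrr. Qed.

Lemma ip_subproj x y :
  (forall i, (i < n)%N -> ip y (e i) = 0) -> ip y (oproj e n x) = 0.
Proof.
move=> h; rewrite /oproj ip_sumr big1 // => i _.
by rewrite ipZr h ?mulr0.
Qed.

Lemma nrm2_subproj x :
  N (x - oproj e n x) = N x - \sum_(i < n) A (ip x (e i)).
Proof.
have NP : N (oproj e n x) = \sum_(i < n) A (ip x (e i)).
  rewrite /nrm2 {1}/oproj ip_suml re_sum; apply: eq_bigr => i _.
  by rewrite ipZl [ip (e i) _]ipC ip_oproj.
have := nrm2D (x - oproj e n x) (oproj e n x).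
rewrite subrK NP ip_subproj; last by move=> i; exact: ip_oproj0.
by rewrite re0; lra.
Qed.

Lemma bessel x : \sum_(i < n) A (ip x (e i)) <= N x.
Proof. by rewrite -subr_ge0 -nrm2_subproj nrm2_ge0. Qed.

Lemma nrm2_subproj_le x : N (x - oproj e n x) <= N x.
Proof.
by rewrite nrm2_subproj gerBl sumr_ge0 // => i _; rewrite (abs2_ge0 HK).
Qed.

End Orthoid.

Lemma orthoid_rcons e n :
  orthoid e n -> (forall i, (i < n)%N -> ip (e n) (e i) = 0) ->
  ip (e n) (e n) *: e n = e n -> orthoid e n.+1.
Proof.
move=> [o1 o2] on idn; split=> [i j|i]; rewrite !ltnS.
  rewrite leq_eqVlt => /predU1P[->|im]; rewrite leq_eqVlt => /predU1P[->|jm].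
  - by rewrite eqxx.
  - by rewrite on.
  - by move=> _; apply: ip_eq0C; exact: on.
  - exact: o1.
by rewrite leq_eqVlt => /predU1P[->//|]; exact: o2.
Qed.

End InnerProduct.

(** * Rotating pairs, equalizing [q] on a list, and peeling off vectors with [q = 1] *)

Section Rotations.
Local Open Scope ring_scope.
Variables (R : realType) (K : fieldType).
Variables (conj : K -> K) (re : K -> R) (ofR : R -> K).
Variables (V : lmodType K) (ip : V -> V -> K).
Hypothesis HK : scalar_field conj re ofR.
Hypothesis HV : is_inner_product conj re ofR ip.

Local Notation N := (nrm2 re ip).
Local Notation A := (abs2 conj re).

Lemma big_mkseq (T W : Type) (idx : W) (op : W -> W -> W) (F : T -> W)
    (x : nat -> T) n :
  \big[op/idx]_(y <- mkseq x n) F y = \big[op/idx]_(i < n) F (x i).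
Proof. by rewrite /mkseq big_map -{1}[n]subn0 -/(index_iota 0 n) big_mkord. Qed.

(** The quadratic form of the frame operator of [s]: two lists with the same [fsum] have the same
    frame operator. *)
Definition fsum (s : seq V) (v : V) : R := \sum_(y <- s) A (ip v y).

Lemma fsum_ge0 s v : 0 <= fsum s v.
Proof. by apply: sumr_ge0 => y _; rewrite (abs2_ge0 HK). Qed.

Lemma fsum_cons x s v : fsum (x :: s) v = A (ip v x) + fsum s v.
Proof. by rewrite /fsum big_cons. Qed.

Lemma fsum_cat s t v : fsum (s ++ t) v = fsum s v + fsum t v.
Proof. by rewrite /fsum big_cat. Qed.

Lemma fsum_mkseq (x : nat -> V) n v :
  fsum (mkseq x n) v = \sum_(i < n) A (ip v (x i)).
Proof. exact: big_mkseq. Qed.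

Lemma ip_ofR_comb v c s x y :
  ip v (ofR c *: x + ofR s *: y) = ofR c * ip v x + ofR s * ip v y.
Proof. by rewrite (ipDr HK HV) !(ipZr HK HV) !(conj_ofR HK). Qed.

Variable S : V -> V.
Hypothesis linS : linear_op S.

Local Notation q x := (N (S x)).

Lemma q_ofRZ c x : q (ofR c *: x) = c ^+ 2 * q x.
Proof. by rewrite (linear_opZ linS) (nrm2_ofRZ HK HV). Qed.

(** [s2] is the squared sine of the angle. The last clause controls how much of [x] survives in the
    leftover [y']. *)
Lemma rotate a x y : q x <= a -> a <= q y ->
  exists x' y' s2, [/\ q x' = a, q y' = q x + q y - a,
    0 <= s2 /\ s2 * q y <= a,
    forall v, A (ip v x') + A (ip v y') = A (ip v x) + A (ip v y) &
    forall v h, 0 < h ->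
      A (ip v y') <= (1 + h) * s2 * A (ip v x) + (1 + h^-1) * A (ip v y)].
Proof.
move=> xa ay.
(* Replacing [y] by [- y] changes the sign of the cross term and affects neither [q y] nor any
   [A (ip v y)]. *)
wlog t0 : y ay / 0 <= re (ip (S x) (S y)).
  have [t0|/ltW t0] := lerP 0 (re (ip (S x) (S y))); first by apply.
  have qN : q (- y) = q y by rewrite (linear_opN linS) (nrm2N HK HV).
  have AN v : A (ip v (- y)) = A (ip v y) by rewrite (ipNr HK HV) (abs2N HK).
  case/(_ (- y)) => [||x' [y' [s2 [q1 q2 s2q fr bnd]]]]; first by rewrite qN.
    by rewrite (linear_opN linS) (ipNr HK HV) (reN HK) oppr_ge0.
  rewrite qN in q2 s2q; exists x', y', s2; split=> // [v|v h].
    by rewrite fr AN.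
  by move=> /(bnd v); rewrite AN.
have [c [s [c0 s0 cs qa sq]]] :=
  rotation_exists (nrm2_ge0 HV _) xa ay t0.
have c1 : c ^+ 2 <= 1 by rewrite -cs lerDl sqr_ge0.
exists (ofR c *: x + ofR s *: y), (ofR (- s) *: x + ofR c *: y), (s ^+ 2).
rewrite !(linear_opD linS) !(linear_opZ linS) !(nrm2_rotation HK HV) sqrrN.
split=> //.
- have -> : s ^+ 2 = 1 - c ^+ 2 by rewrite -cs; ring.
  by move: qa; have -> : s ^+ 2 = 1 - c ^+ 2 by [rewrite -cs; ring]; lra.
- by split=> //; rewrite sqr_ge0.
- move=> v; rewrite !ip_ofR_comb !(abs2_rotation HK) sqrrN.
  have -> : s ^+ 2 = 1 - c ^+ 2 by rewrite -cs; ring.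
  ring.
move=> v h h0; rewrite ip_ofR_comb (le_trans (abs2_leD HK _ _ h0)) //.
rewrite !(abs2M HK) !(abs2_ofR HK) sqrrN mulrA lerD2l.
apply: ler_wpM2l; first by rewrite addr_ge0 // invr_ge0 ltW.
by rewrite ler_piMl // (abs2_ge0 HK).
Qed.

Lemma sum_le_exists (T : eqType) (F : T -> R) (s : seq T) a :
  (0 < size s)%N -> \sum_(y <- s) F y <= (size s)%:R * a ->
  exists2 y, y \in s & F y <= a.
Proof.
move=> s0 le_sum; apply: contrapT => nex.
have gt_a y : y \in s -> a < F y.
  by move=> ys; rewrite ltNge; apply/negP => le; apply: nex; exists y.
have : \sum_(y <- s) a < \sum_(y <- s) F y.
  case: s s0 {le_sum nex} gt_a => // z s _ gt_a.
  rewrite !big_cons ltr_leD ?gt_a ?mem_head // big_seq [leRHS]big_seq.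
  by apply: ler_sum => y ys; rewrite ltW // gt_a // in_cons ys orbT.
rewrite big_const_seq count_predT iter_addr addr0 -[a *+ _]mulr_natl => lt.
by have := le_lt_trans le_sum lt; rewrite ltxx.
Qed.

(** One vector is settled at a time: some [x] has value at most the average [a], some other [y] at
    least [a]. After rotation one of the two has value [a], and the other returns to the list, whose
    average is still [a]. *)
Lemma equalize (s : seq V) a :
    \sum_(y <- s) q y = (size s)%:R * a ->
  exists s' : seq V, [/\ size s' = size s, forall y, y \in s' -> q y = a &
    forall v, fsum s' v = fsum s v].
Proof.
move En : (size s) => n; elim: n s En => [|n IH] s sn sum_s.
  by exists [::]; split=> // v; rewrite (size0nil sn).
have [||x xs qx] := @sum_le_exists _ (fun y => q y) s a.
- by rewrite sn.
- by rewrite sn sum_s.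
have px := perm_to_rem xs; set r := rem x s in px.
have sr : size r = n by have := perm_size px; rewrite sn /= => -[].
have sum_r : q x + \sum_(y <- r) q y = n.+1%:R * a.
  by rewrite -sum_s (perm_big _ px) big_cons.
have fs_r v : fsum s v = A (ip v x) + fsum r v.
  by rewrite /fsum (perm_big _ px) big_cons.
case: n => [|n] in IH sn sum_s sr sum_r *.
  move: sum_r; rewrite (size0nil sr) big_nil addr0 mul1r => qxa.
  exists [:: x]; split=> // [y|v]; first by rewrite inE => /eqP ->.
  by rewrite fs_r fsum_cons (size0nil sr).
(* Since [q x <= a], the remaining vectors average at least [a]; the averaging argument for [- q]
   yields [y]. *)
have [||y yr] := @sum_le_exists _ (fun y => - q y) r (- a).
- by rewrite sr.
- move: sum_r; rewrite sr sumrN mulrN lerN2 -natr1 mulrDl mul1r; lra.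
rewrite lerN2 => qy.
have py := perm_to_rem yr; set t := rem y r in py.
have st : size t = n by have := perm_size py; rewrite sr /= => -[].
have [x' [y' [s2 [qx' qy' _ fr _]]]] := rotate qx qy.
have [||s' [ss' qs' fs']] := IH (y' :: t).
- by rewrite /= st.
- rewrite big_cons qy'; move: sum_r.
  by rewrite (perm_big _ py) big_cons -[n.+2%:R]natr1 mulrDl mul1r /=; lra.
exists (x' :: s'); split=> [|z|v]; first by rewrite /= ss'.
  by rewrite inE => /predU1P[->//|]; exact: qs'.
rewrite fs_r fsum_cons fs' fsum_cons addrA fr /fsum (perm_big _ py) big_cons.
by rewrite addrA.
Qed.

(** [A (ip v z)] splits along multiples of [z] whose squared factors add up to 1: [n] copies with
    squared factor [b = 1 / q z], each of value 1, and one with [1 - n b], whose value is the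
    fractional part of [q z]. *)
Lemma peel z : exists (L : seq V) z', [/\ forall y, y \in L -> q y = 1,
  q z' < 1 & forall v, fsum L v + A (ip v z') = A (ip v z)].
Proof.
pose n := Num.truncn (q z).
have qz0 : 0 <= q z := nrm2_ge0 HV _.
have nq : n%:R <= q z by rewrite truncn_le.
have qn : q z < n%:R + 1 by rewrite natr1 truncnS_gt.
(* If [q z = 0], then [b = 0] by the convention for inverses, and [n = 0] makes the list empty. *)
pose b := (q z)^-1.
have b0 : 0 <= b by rewrite invr_ge0.
have bq : q z != 0 -> b * q z = 1 by move=> h; rewrite mulVf.
have nb : n%:R * b * q z = n%:R.
  have [q0|/bq] := eqVneq (q z) 0; last by rewrite -mulrA => ->; rewrite mulr1.
  by move: nq; rewrite q0 mulr0 lern0 => /eqP ->.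
have d0 : 0 <= 1 - n%:R * b.
  have [q0|q0] := eqVneq (q z) 0.
    by move: nq; rewrite q0 lern0 => /eqP ->; rewrite mul0r subr0.
  by rewrite subr_ge0 ler_pdivrMr ?mul1r // lt_neqAle eq_sym q0.
exists (nseq n (ofR (Num.sqrt b) *: z)), (ofR (Num.sqrt (1 - n%:R * b)) *: z).
split=> [y|| v].
- rewrite mem_nseq => /andP[n0 /eqP ->]; rewrite q_ofRZ sqr_sqrtr // bq //.
  by rewrite gt_eqF //; apply: lt_le_trans nq; rewrite ltr0n.
- by rewrite q_ofRZ sqr_sqrtr // mulrBl nb mul1r; lra.
rewrite /fsum big_nseq iter_addr addr0 !(ipZr HK HV) !(conj_ofR HK).
by rewrite !(abs2M HK) !(abs2_ofR HK) !sqr_sqrtr // -mulr_natl; ring.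
Qed.

(** Rotating to the value 1 gives [s2 * q x <= 1], so [s2 <= 1 / (1 + d)]. With weight [h = d / 2]
    the old leftover enters with coefficient [(1 + d / 2) / (1 + d) < 1], and peeling only decreases
    [A (ip v _)]. *)
Lemma consume d z x : 0 < d -> q z < 1 -> 1 + d <= q x ->
  exists (L : seq V) z', [/\ (0 < size L)%N, forall y, y \in L -> q y = 1,
    q z' < 1, forall v, fsum L v + A (ip v z') = A (ip v z) + A (ip v x) &
    forall v, A (ip v z') <=
      (1 + d / 2) / (1 + d) * A (ip v z) + (1 + (d / 2)^-1) * A (ip v x)].
Proof.
move=> d0 qz qx.
have [||y [w [s2 [qy _ [s20 s2q] fr bnd]]]] := @rotate 1 z x.
- exact: ltW.
- by apply: le_trans qx; rewrite lerDl ltW.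
have [L [z' [qL qz' fL]]] := peel w.
exists (y :: L), z'; split=> // [u|v|v].
- by rewrite inE => /predU1P[->//|]; exact: qL.
- by rewrite fsum_cons -addrA fL fr.
have le_w : A (ip v z') <= A (ip v w) by rewrite -fL lerDr fsum_ge0.
have h0 : 0 < d / 2 by rewrite divr_gt0.
rewrite (le_trans le_w) // (le_trans (bnd v _ h0)) // lerD2r.
apply: ler_wpM2r; first by rewrite (abs2_ge0 HK).
apply: ler_wpM2l; first by rewrite addr_ge0 // ltW.
have d1 : 0 < 1 + d by rewrite addr_gt0.
rewrite -[leRHS]mul1r ler_pdivlMr // (le_trans _ s2q) //.
exact: ler_wpM2l.
Qed.

End Rotations.

(** * Tight sequences, concatenation of blocks, and the greedy passage to the ellipsoid *)

Section TightSequences.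
Local Open Scope ring_scope.
Variables (R : realType) (K : fieldType).
Variables (conj : K -> K) (re : K -> R) (ofR : R -> K).
Variables (V : lmodType K) (ip : V -> V -> K).
Hypothesis HK : scalar_field conj re ofR.
Hypothesis HV : is_inner_product conj re ofR ip.

Local Notation N := (nrm2 re ip).
Local Notation A := (abs2 conj re).
Local Notation fsum := (fsum conj re ip).

(** The identity [sum_i |<v, x_i>|^2 = k |v|^2] in terms of real partial sums. *)
Definition tight_seq (x : nat -> V) (k : R) : Prop := forall v,
  (forall n, \sum_(i < n) A (ip v (x i)) <= k * N v) /\
  (forall e, 0 < e -> exists n, k * N v - e <= \sum_(i < n) A (ip v (x i))).

Lemma psum_mono (x : nat -> V) v m n : (m <= n)%N ->
  \sum_(i < m) A (ip v (x i)) <= \sum_(i < n) A (ip v (x i)).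
Proof.
move=> /subnKC <-; rewrite big_split_ord /= lerDl sumr_ge0 // => i _.
exact: (abs2_ge0 HK).
Qed.

(** As no block is empty, the first [j + 1] blocks have more than [j] entries, so the entry [j] of
    the infinite concatenation can be read off there. *)
Lemma flatten_blocks (B : nat -> seq V) : (forall m, (0 < size (B m))%N) ->
  exists f : nat -> V, (forall j, exists m, f j \in B m) /\
    forall m, mkseq f (size (flatten (mkseq B m))) = flatten (mkseq B m).
Proof.
move=> B0; pose F m := flatten (mkseq B m).
have FS m : F m.+1 = F m ++ B m.
  by rewrite /F mkseqS -cats1 flatten_cat /= cats0.
have sF m : (m <= size (F m))%N.
  elim: m => // m IH; rewrite FS size_cat -addn1; exact: leq_add.
have sizeF m l : (size (F m) <= size (F (l + m)))%N.
  by elim: l => // l IH; rewrite addSn FS size_cat (leq_trans IH) // leq_addr.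
have nthF i m n : (m <= n)%N -> (i < size (F m))%N -> (F n)`_i = (F m)`_i.
  move=> /subnK <- im; elim: (n - m)%N => // l IH.
  by rewrite addSn FS nth_cat (leq_trans im (sizeF m l)).
have nthf j m : (j < size (F m))%N -> (F j.+1)`_j = (F m)`_j.
  move=> jm; have [le|le] := leqP j.+1 m.
    by rewrite (nthF _ _ _ le) // sF.
  by rewrite (nthF _ _ _ (ltnW le)).
exists (fun j => (F j.+1)`_j); split=> [j|m].
  have /(mem_nth 0)/flattenP[s] := sF j.+1.
  by rewrite /mkseq => /mapP[m _ ->] ?; exists m.
apply: (@eq_from_nth _ 0); first by rewrite size_mkseq.
by move=> i; rewrite size_mkseq => im; rewrite nth_mkseq //; exact: nthf.
Qed.

(** Partial sums increase, so control at the block boundaries is enough. *)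
Lemma tight_blocks (B : nat -> seq V) k : (forall m, (0 < size (B m))%N) ->
    (forall v m, \sum_(j < m) fsum (B j) v <= k * N v) ->
    (forall v e, 0 < e -> exists m, k * N v - e <= \sum_(j < m) fsum (B j) v) ->
  exists f : nat -> V, (forall j, exists m, f j \in B m) /\ tight_seq f k.
Proof.
move=> B0 ub lb; have [f [fB fE]] := flatten_blocks B0; exists f; split=> // v.
have sumF m : fsum (flatten (mkseq B m)) v = \sum_(j < m) fsum (B j) v.
  elim: m => [|m IH]; first by rewrite big_ord0 /fsum big_nil.
  by rewrite mkseqS -cats1 flatten_cat /= cats0 fsum_cat IH big_ord_recr.
have sumf m : \sum_(i < size (flatten (mkseq B m))) A (ip v (f i)) =
    \sum_(j < m) fsum (B j) v.
  by rewrite -(@fsum_mkseq _ _ conj re _ ip f) fE sumF.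
have sF m : (m <= size (flatten (mkseq B m)))%N.
  elim: m => // m IH; rewrite mkseqS -cats1 flatten_cat /= cats0 size_cat.
  by rewrite -addn1 leq_add.
split=> [n|e e0].
  by rewrite (le_trans (psum_mono f v (sF n))) // sumf.
by have [m hm] := lb v e e0; exists (size (flatten (mkseq B m))); rewrite sumf.
Qed.

Lemma tight_seqZ (x : nat -> V) k c : 0 < c -> tight_seq x k ->
  tight_seq (fun i => ofR c *: x i) (c ^+ 2 * k).
Proof.
move=> c0 tx v; have [ub lb] := tx v.
have c20 : 0 < c ^+ 2 by rewrite exprn_gt0.
have sumE n : \sum_(i < n) A (ip v (ofR c *: x i)) =
    c ^+ 2 * \sum_(i < n) A (ip v (x i)).
  rewrite mulr_sumr; apply: eq_bigr => i _.
  by rewrite (ipZr HK HV) (conj_ofR HK) (abs2M HK) (abs2_ofR HK).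
split=> [n|e e0]; first by rewrite sumE -[leRHS]mulrA ler_pM2l.
have [|n hn] := lb (e / c ^+ 2); first by rewrite divr_gt0.
exists n; rewrite sumE.
have -> : c ^+ 2 * k * N v - e = c ^+ 2 * (k * N v - e / c ^+ 2).
  by field; rewrite gt_eqF.
by rewrite ler_pM2l.
Qed.

Section Ellipsoid.
Variable S : V -> V.
Hypothesis linS : linear_op S.
Local Notation q x := (N (S x)).

(** Equalizing inside each block of [p] vectors gives all of them the block average and leaves the
    frame sums at block boundaries unchanged. *)
Lemma tight_average (x : nat -> V) k p d : (0 < p)%N -> tight_seq x k ->
    (forall m, p%:R * d <= \sum_(r < p) q (x (m * p + r)%N)) ->
  exists y : nat -> V, tight_seq y k /\ forall i, d <= q (y i).
Proof.
move=> p0 tx avg; have pR : 0 < p%:R :> R by rewrite ltr0n.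
pose X m := mkseq (fun r => x (m * p + r)%N) p.
have /choice[B HB] m : exists s' : seq V, [/\ size s' = p,
    forall y, y \in s' -> d <= q y & forall v, fsum s' v = fsum (X m) v].
  have [|s' [ss' qs' fs']] :=
      @equalize _ _ _ _ _ _ _ HK HV _ linS (X m) ((\sum_(y <- X m) q y) / p%:R).
    by rewrite size_mkseq mulrC divfK // gt_eqF.
  exists s'; split=> // [|y /qs' ->]; first by rewrite ss' size_mkseq.
  rewrite ler_pdivlMr // mulrC (le_trans (avg m)) //.
  by rewrite /X big_mkseq.
have sumB v m : \sum_(j < m) fsum (B j) v = \sum_(i < m * p) A (ip v (x i)).
  elim: m => [|m IH]; first by rewrite mul0n !big_ord0.
  rewrite big_ord_recr /= IH mulSnr big_split_ord /=; congr (_ + _).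
  by have [_ _ ->] := HB m; rewrite fsum_mkseq.
have [m|v m|v e e0|y [yB ty]] := @tight_blocks B k.
- by have [-> _ _] := HB m.
- by rewrite sumB; have [ub _] := tx v; exact: ub.
- have [_ lb] := tx v; have [n hn] := lb e e0; exists n.
  by rewrite sumB (le_trans hn) // psum_mono // leq_pmulr.
exists y; split=> // i; have [m yi] := yB i.
by have [_ + _] := HB m; apply.
Qed.

Lemma tight_on_ellipsoid (x : nat -> V) k d : 0 < d -> tight_seq x k ->
    (forall i, 1 + d <= q (x i)) ->
  exists f : nat -> V, tight_seq f k /\ forall j, q (f j) = 1.
Proof.
move=> d0 tx qx.
(* Outside the admissible pairs [step] takes the dummy value [([::], 0)], which makes it a total
   function. *)
have /choice[step Hstep] (p : V * V) : exists r : seq V * V,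
    q p.1 < 1 -> 1 + d <= q p.2 -> [/\ (0 < size r.1)%N,
    forall y, y \in r.1 -> q y = 1, q r.2 < 1,
    forall v, fsum r.1 v + A (ip v r.2) = A (ip v p.1) + A (ip v p.2) &
    forall v, A (ip v r.2) <= (1 + d / 2) / (1 + d) * A (ip v p.1) +
      (1 + (d / 2)^-1) * A (ip v p.2)].
  have [p1|p1] := boolP (q p.1 < 1); last by exists ([::], 0).
  have [p2|p2] := boolP (1 + d <= q p.2); last by exists ([::], 0).
  have [L [z H]] := consume HK HV linS d0 p1 p2.
  by exists (L, z).
(* [Z m] is the leftover just before [x m] is consumed. *)
pose fix Z m := if m is m'.+1 then (step (Z m', x m')).2 else 0.
have qZ m : q (Z m) < 1.
  elim: m => [|m IH] /=.
    by rewrite (linear_op0 linS) (nrm2_0 HK HV) ltr01.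
  by have [] := Hstep (Z m, x m) IH (qx m).
pose B m := (step (Z m, x m)).1.
have HB m := Hstep (Z m, x m) (qZ m) (qx m).
(* Telescoping: output and leftover together carry the frame sum of the vectors consumed so far. *)
have sumB v m : \sum_(j < m) fsum (B j) v =
    \sum_(i < m) A (ip v (x i)) - A (ip v (Z m)).
  elim: m => [|m IH].
    by rewrite !big_ord0 /= (ip0r HK HV) (abs2_0 HK) subrr.
  rewrite !big_ord_recr /= IH.
  by have [_ _ _ /(_ v) /= h _] := HB m; rewrite /B; lra.
have [m|v m|v e e0|f [fB tf]] := @tight_blocks B k.
- by have [] := HB m.
- have [ub _] := tx v; rewrite sumB (le_trans _ (ub m)) // gerBl.
  exact: (abs2_ge0 HK).
- have [ub lb] := tx v; have e2 : 0 < e / 2 by rewrite divr_gt0.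
  have [n hn] := lb _ e2.
  have d1 : 0 < 1 + d by rewrite addr_gt0.
  (* The leftovers contract up to terms [A (ip v (x m))] with sums at most [k * N v], so some
     leftover at an index past [n] falls below [e / 2]. *)
  have [||||||m nm am] := @contraction_vanishes _ ((1 + d / 2) / (1 + d))
      (1 + (d / 2)^-1) (fun m => A (ip v (Z m))) (fun m => A (ip v (x m)))
      (k * N v) _ _ _ _ _ _ (e / 2) n e2.
  + by rewrite divr_ge0 ?(ltW d1) // addr_ge0 // divr_ge0 // ltW.
  + by rewrite ltr_pdivrMr // mul1r; lra.
  + by rewrite addr_ge0 // invr_ge0 divr_ge0 // ltW.
  + by move=> m; exact: (abs2_ge0 HK).
  + by move=> m; have [_ _ _ _] := HB m; apply.
  + exact: ub.
  exists m; rewrite sumB; have := psum_mono x v nm; lra.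
exists f; split=> // j; have [m fm] := fB j.
by have [_ + _ _ _] := HB m; apply.
Qed.

End Ellipsoid.

Lemma tight_seq_frame (f : nat -> V) k : 0 < k -> tight_seq f k ->
  tight_frame conj re ip f k.
Proof.
move=> k0 tf; split=> // v; have [ub lb] := tf v.
have nneg i : (0 <= (A (ip v (f i)))%:E)%E by rewrite lee_fin (abs2_ge0 HK).
suff -> : frame_sum conj re ip f v = (k * N v)%:E by split.
have -> : frame_sum conj re ip f v = (\sum_(i <oo) (A (ip v (f i)))%:E)%E.
  by rewrite nneseries_esumT.
apply/eqP; rewrite eq_le; apply/andP; split.
  apply: lime_le; first exact: is_cvg_nneseries.
  by apply: nearW => n; rewrite sumEFin lee_fin big_mkord.
apply/lee_addgt0Pr => e e0; have [n hn] := lb e e0.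
apply: le_trans (_ : ((\sum_(i < n) A (ip v (f i))) + e)%:E <= _)%E.
  by rewrite lee_fin -lerBlDr.
rewrite EFinD leeD2r // -sumEFin.
apply: le_trans (nneseries_lim_ge n _); last by [].
by rewrite big_mkord.
Qed.

Lemma frame_sum_ord n (f : 'I_n -> V) v :
  frame_sum conj re ip f v = (\sum_(i < n) A (ip v (f i)))%:E.
Proof.
rewrite /frame_sum esum_fset //;
  last by move=> i _; rewrite lee_fin (abs2_ge0 HK).
rewrite -sumEFin (@fsbigE _ _ _ _ _ (index_enum 'I_n)) ?index_enum_uniq //.
- by apply: eq_bigl => i; rewrite in_setT.
- by move=> i _; rewrite mem_index_enum.
exact: finite_finset.
Qed.

End TightSequences.

(** * Gram-Schmidt, existence of tight sequences, and the finite-dimensional case *)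

Section GramSchmidt.
Local Open Scope ring_scope.
Variables (R : realType) (K : fieldType).
Variables (conj : K -> K) (re : K -> R) (ofR : R -> K).
Variables (V : lmodType K) (ip : V -> V -> K).
Hypothesis HK : scalar_field conj re ofR.
Hypothesis HV : is_inner_product conj re ofR ip.

Local Notation N := (nrm2 re ip).
Local Notation A := (abs2 conj re).
Local Notation orthoid := (orthoid ip).
Local Notation oproj := (oproj ip).
Local Notation tight_seq := (tight_seq conj re ip).

(** Dependent choice with full history: a choice function on finite lists is iterated, and the first
    hypothesis says that [P n e x] depends only on the first [n] values of [e]. *)
Lemma dependent_sequence (T : Type) (t0 : T)
    (P : nat -> (nat -> T) -> T -> Prop) :
    (forall n e e' x, (forall i, (i < n)%N -> e i = e' i) ->
      P n e x -> P n e' x) ->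
    (forall n e, exists x, P n e x) ->
  exists e, forall n, P n e (e n).
Proof.
move=> ext ex.
have /choice[G HG] (s : seq T) : exists x, P (size s) (nth t0 s) x by exact: ex.
pose L n := iter n (fun s => rcons s (G s)) [::].
have LE n : L n = mkseq (fun i => G (L i)) n.
  by elim: n => // n IH; rewrite mkseqS -IH.
exists (fun i => G (L i)) => n; have := HG (L n).
rewrite {1 2}LE size_mkseq; apply: ext => i i_n.
by rewrite nth_mkseq.
Qed.

Lemma orthoid_eq e e' n : (forall i, (i < n)%N -> e i = e' i) ->
  orthoid e n -> orthoid e' n.
Proof.
by move=> ee' [o1 o2]; split=> [i j im jm|i im]; rewrite -!ee' //;
  [exact: o1|exact: o2].
Qed.

Lemma oproj_eq e e' n x : (forall i, (i < n)%N -> e i = e' i) ->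
  oproj e n x = oproj e' n x.
Proof. by move=> ee'; apply: eq_bigr => i _; rewrite ee'. Qed.

Lemma oproj_rcons e n x : oproj e n.+1 x = oproj e n x + ip x (e n) *: e n.
Proof. by rewrite /oproj big_ord_recr. Qed.

(** [x] is the normalized residual of [d], or 0 when [d] is already in the span. *)
Lemma orthoid_extend e n d : orthoid e n -> exists x,
  [/\ forall i, (i < n)%N -> ip x (e i) = 0, ip x x *: x = x &
      oproj e n d + ip d x *: x = d].
Proof.
move=> oe; pose u := d - oproj e n d.
have u0 i : (i < n)%N -> ip u (e i) = 0 by exact: (ip_oproj0 HK HV oe).
have [Nu|Nu] := eqVneq (N u) 0.
  exists 0; split=> [i _||]; rewrite ?(ip0l HV) ?scaler0 //.
  by have /subr0_eq {2}-> := nrm2_eq0 HV Nu; rewrite addr0.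
have Nu0 : 0 < N u by rewrite lt_neqAle eq_sym Nu (nrm2_ge0 HV).
have sN : Num.sqrt (N u) != 0 by rewrite sqrtr_eq0 -ltNge.
pose c := (Num.sqrt (N u))^-1.
have c2 : c * c * N u = 1.
  by rewrite -[N u]sqr_sqrtr ?ltW // /c; field.
(* [d - u] is a projection, hence orthogonal to [u]. *)
have du : ip d u = ofR (N u).
  rewrite -(ipxx HV) {1}/u (ipBl HV).
  rewrite [ip (oproj e n d) u](ip_eq0C HK HV) ?subr0 //.
  exact: (ip_subproj HK HV).
exists (ofR c *: u); split=> [i i_n||].
- by rewrite (ipZl HV) u0 ?mulr0.
- by rewrite (ipxx HV) (nrm2_ofRZ HK HV) expr2 c2 (ofR1 HK) scale1r.
rewrite (ipZr HK HV) (conj_ofR HK) du scalerA mulrAC -!(ofRM HK) c2 (ofR1 HK).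
by rewrite scale1r addrC subrK.
Qed.

(* Indices divisible by p absorb the vectors D m, so that the family spans; the
   other ones are free to be chosen with property Q. *)
Lemma gram_schmidt (p : nat) (D : nat -> V) (Q : V -> Prop) : (0 < p)%N ->
    ((1 < p)%N -> forall n e, orthoid e n -> exists x,
      [/\ forall i, (i < n)%N -> ip x (e i) = 0, N x = 1 & Q x]) ->
  exists e, [/\ forall n, orthoid e n,
    forall m, oproj e (m * p).+1 (D m) = D m &
    forall n, ~~ (p %| n)%N -> N (e n) = 1 /\ Q (e n)].
Proof.
move=> p0 HQ.
(* Orthogonality of the history is a premise inside the predicate, so that a choice exists for every
   [e]; an induction then discharges it for the sequence obtained. *)
have [|n e|e He] := @dependent_sequence V 0 (fun n e x => orthoid e n ->
  [/\ forall i, (i < n)%N -> ip x (e i) = 0, ip x x *: x = x,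
    (p %| n)%N ->
      oproj e n (D (n %/ p)%N) + ip (D (n %/ p)%N) x *: x = D (n %/ p)%N &
    ~~ (p %| n)%N -> N x = 1 /\ Q x]).
- move=> n e e' x ee' H oe'.
  have [|o1 o2 o3 o4] := H; first by apply: orthoid_eq oe' => i /ee' ->.
  split=> // [i i_n|]; first by rewrite -ee' // o1.
  by rewrite -(oproj_eq _ ee').
- have [oe|noe] := pselect (orthoid e n); last by exists 0 => /noe.
  have [pn|pn] := boolP (p %| n)%N.
    by have [x [x1 x2 x3]] := orthoid_extend (D (n %/ p)%N) oe; exists x.
  have p1 : (1 < p)%N.
    by rewrite ltn_neqAle p0 andbT; apply: contra pn => /eqP <-; rewrite dvd1n.
  have [x [x1 x2 x3]] := HQ p1 n e oe; exists x => _; split=> //.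
  by rewrite (ipxx HV) x2 (ofR1 HK) scale1r.
have oe n : orthoid e n.
  elim: n => [|n IH]; first by split.
  by have [o1 o2 _ _] := He n IH; exact: (orthoid_rcons HK HV).
exists e; split=> // [m|n pn]; last by have [_ _ _] := He n (oe n); apply.
have [_ _ + _] := He (m * p)%N (oe _); rewrite dvdn_mull // mulnK // => h.
by rewrite oproj_rcons h.
Qed.

Lemma orthoid_mono e m n x : orthoid e n -> (m <= n)%N ->
  N (x - oproj e n x) <= N (x - oproj e m x).
Proof.
move=> oe mn; have om := orthoid_sub mn oe.
rewrite !(nrm2_subproj HK HV) // lerD2l lerN2.
exact: (psum_mono ip HK e x mn).
Qed.

(** Bessel gives the upper bound. If some projection fixes [D m], then [v] and [v - D m] have the
    same residual, which is small when [D m] is close to [v]. *)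
Lemma orthoid_tight (D e : nat -> V) :
    (forall x eps, 0 < eps -> exists n, nrm re ip (x - D n) < eps) ->
    (forall n, orthoid e n) -> (forall m, exists n, oproj e n (D m) = D m) ->
  tight_seq e 1.
Proof.
move=> dense oe eD v; rewrite mul1r; split=> [n|eps eps0].
  exact: (bessel HK HV (oe n)).
have [|m vm] := dense v (Num.sqrt eps); first by rewrite sqrtr_gt0.
have [n pn] := eD m; exists n.
rewrite lerBlDl -lerBlDr -(nrm2_subproj HK HV (oe n)).
have -> : v - oproj e n v = (v - D m) - oproj e n (v - D m).
  by rewrite (linear_opB (oproj_linear HV e n)) pn opprB addrA subrK.
rewrite (le_trans (nrm2_subproj_le HK HV (oe n) _)) //.
move: vm; rewrite (nrm_ltP HV) ?sqrtr_ge0 // sqr_sqrtr ?(ltW eps0) //.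
exact: ltW.
Qed.

Variable S : V -> V.
Hypothesis linS : linear_op S.
Local Notation q x := (N (S x)).

Lemma tight_seq_exists k d : 0 < k -> 0 < d -> separable_space re ip ->
    (forall n e, orthoid e n -> exists x,
      [/\ forall i, (i < n)%N -> ip x (e i) = 0, N x = 1 & 1 + d <= k * q x]) ->
  exists f : nat -> V, tight_seq f k /\ forall j, q (f j) = 1.
Proof.
move=> k0 d0 [D dense] big.
have d2 : 0 < d / 2 by rewrite divr_gt0.
(* This makes [M * (1 + d) >= (M + 1) * (1 + d / 2)]: [M] large values make up for one value known
   only to be nonnegative. *)
have [M hM] : exists M, 1 + d / 2 <= M%:R * (d / 2).
  exists (Num.truncn ((1 + d / 2) / (d / 2))).+1.
  by rewrite -ler_pdivrMr // ltW // truncnS_gt.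
pose p := M.+1.
have [||e [oe eD ebig]] := @gram_schmidt p D (fun x => 1 + d <= k * q x).
- by [].
- by move=> _; exact: big.
have te : tight_seq e 1.
  by apply: orthoid_tight dense oe _ => m; exists (m * p).+1.
have sk : 0 < Num.sqrt k by rewrite sqrtr_gt0.
have := tight_seqZ HK HV sk te; rewrite sqr_sqrtr ?(ltW k0) // mulr1 => tk.
have [|m|y [ty yq]] := tight_average HK HV linS (p := p) (d := 1 + d / 2) _ tk.
- by [].
(* The first vector of each block has index divisible by [p] and is bounded below by 0; the other
   [M] have value at least [1 + d]. *)
- rewrite big_ord_recl /= -[leLHS]add0r lerD ?(nrm2_ge0 HV) //.
  apply: (@le_trans _ _ (\sum_(r < M) (1 + d))).
    have -> : \sum_(r < M) (1 + d) = M%:R * (1 + d / 2) + M%:R * (d / 2).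
      by rewrite sumr_const card_ord -[LHS]mulr_natl; field.
    by rewrite -[p%:R]natr1 mulrDl mul1r lerD2l.
  apply: ler_sum => r _; rewrite (q_ofRZ HK HV linS) sqr_sqrtr ?(ltW k0) //.
  apply: (ebig _ _).2; rewrite dvdn_addr ?dvdn_mull //.
  rewrite /bump /= add1n; apply/negP => /dvdn_leq => /(_ isT).
  by rewrite /p ltnS leqNgt ltn_ord.
exact: (tight_on_ellipsoid HK HV linS d2 ty yq).
Qed.

Lemma independent_nonzero n (b : 'I_n -> V) i :
    (forall c : 'I_n -> K, \sum_(i < n) c i *: b i = 0 -> forall i, c i = 0) ->
  b i != 0.
Proof.
move=> indep; apply/eqP => bi0.
have := indep (fun j => (j == i)%:R) _ i; rewrite eqxx => h.
have /eqP : (1 : K) = 0; last by rewrite oner_eq0.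
apply: h; apply: big1 => j _.
by have [->|] := eqVneq j i; rewrite ?bi0 ?scaler0 // scale0r.
Qed.

Definition extend_ord n (b : 'I_n -> V) (k : nat) : V := oapp b 0 (insub k).

Lemma extend_ordE n (b : 'I_n -> V) (i : 'I_n) : extend_ord b i = b i.
Proof. by rewrite /extend_ord valK. Qed.

(** Parseval's identity tolerates zero vectors among the [e i]; one nonzero vector keeps the sum of
    their [q]-values positive. *)
Lemma parseval_finite_dim n : has_dim V n -> (0 < n)%N ->
  exists e : nat -> V, (forall v, \sum_(i < n) A (ip v (e i)) = N v) /\
    exists i : 'I_n, e i != 0.
Proof.
move=> [b [indep gen]] n0.
(* With [p = 1] every index absorbs a basis vector, and no free choice remains. *)
have [//|e [oe eD _]] := @gram_schmidt 1 (extend_ord b) (fun=> True) isT.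
have Pe v : oproj e n v = v.
  have [c ->] := gen v; rewrite (linear_op_sum (oproj_linear HV e n)).
  apply: eq_bigr => i _; rewrite (linear_opZ (oproj_linear HV e n)).
  congr (_ *: _).
  have := eD i; rewrite muln1 extend_ordE => h.
  have := orthoid_mono (b i) (oe n) (ltn_ord i).
  rewrite h subrr (nrm2_0 HK HV) => le0.
  apply/esym/subr0_eq/(nrm2_eq0 HV)/eqP; rewrite eq_le le0 /=.
  exact: (nrm2_ge0 HV).
exists e; split=> [v|].
  by have := nrm2_subproj HK HV (oe n) v; rewrite Pe subrr (nrm2_0 HK HV); lra.
apply: contrapT => nex.
have /eqP := independent_nonzero (Ordinal n0) indep; apply.
rewrite -[b _]Pe /oproj big1 // => i _.
have [->|ei] := eqVneq (e i) 0; first by rewrite scaler0.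
by case: nex; exists i.
Qed.

Lemma tight_finite_exists n k : has_dim V n -> (0 < n)%N -> (n <= k)%N ->
    (forall x, q x = 0 -> x = 0) ->
  exists (f : 'I_k -> V) a,
    (forall j, q (f j) = 1) /\ tight_frame conj re ip f a.
Proof.
move=> dimn n0 nk q0; have [e [pe [i0 ei0]]] := parseval_finite_dim dimn n0.
pose Q := \sum_(i < n) q (e i).
have Q0 : 0 < Q.
  rewrite /Q (bigD1 i0) //= ltr_pwDl ?sumr_ge0 // => [|i _]; last first.
    exact: (nrm2_ge0 HV).
  rewrite lt_neqAle (nrm2_ge0 HV) andbT eq_sym; apply/eqP => /q0 /eqP.
  by rewrite (negbTE ei0).
have k0 : 0 < k%:R :> R by rewrite ltr0n (leq_trans n0).
(* Scaling by [sqrt a] makes the [q]-values add up to [k], so the padded list of length [k] has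
   average 1. *)
pose a : R := k%:R / Q; have a0 : 0 < a by rewrite divr_gt0.
pose s := mkseq (fun i => if (i < n)%N then ofR (Num.sqrt a) *: e i else 0) k.
have sum_s (F : V -> R) : F 0 = 0 ->
    \sum_(y <- s) F y = \sum_(i < n) F (ofR (Num.sqrt a) *: e i).
  move=> F0; rewrite big_mkseq.
  rewrite (big_ord_widen k (fun i => F (ofR (Num.sqrt a) *: e i)) nk).
  rewrite [RHS]big_mkcond /=; apply: eq_bigr => i _.
  by case: ifP.
have [|s' [ss' qs' fs']] := @equalize _ _ _ _ _ _ _ HK HV _ linS s 1.
  rewrite sum_s; last by rewrite (linear_op0 linS) (nrm2_0 HK HV).
  under eq_bigr do rewrite (q_ofRZ HK HV linS) sqr_sqrtr ?(ltW a0) //.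
  by rewrite -mulr_sumr -/Q size_mkseq mulr1 divfK // gt_eqF.
rewrite size_mkseq in ss'.
exists (fun j => s'`_j), a; split=> [j|].
  by apply: qs'; rewrite mem_nth // ss'.
suff H v : frame_sum conj re ip (fun j : 'I_k => s'`_j) v = (a * N v)%:E.
  by split=> // v; rewrite H.
rewrite (frame_sum_ord ip HK); congr (_%:E).
transitivity (fsum conj re ip s' v).
  by rewrite /fsum (big_nth 0) ss' big_mkord.
rewrite fs' /fsum sum_s; last by rewrite (ip0r HK HV) (abs2_0 HK).
under eq_bigr do rewrite (ipZr HK HV) (conj_ofR HK) (abs2M HK) (abs2_ofR HK)
  sqr_sqrtr ?(ltW a0) //.
by rewrite -mulr_sumr pe.
Qed.

Lemma onb_parseval n (e : 'I_n -> V) v : onb ip e ->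
  \sum_(i < n) A (ip (e i) v) = N v.
Proof.
move=> [on gen]; have [c ->] := gen v.
rewrite /nrm2 (ip_suml HV) (re_sum HK); apply: eq_bigr => i _.
rewrite (ipZl HV) [ip (e i) _](ipC HV) (abs2_conj HK).
suff -> : ip (\sum_(j < n) c j *: e j) (e i) = c i by [].
rewrite (ip_suml HV) (bigD1 i) //= big1 => [|j ji].
  by rewrite (ipZl HV) on eqxx mulr1 addr0.
by rewrite (ipZl HV) on (negbTE ji) mulr0.
Qed.

(** Double counting of [|<S e_i, f_j>|^2 = |<e_i, S f_j>|^2]: summing over [j] first gives
    [a * q (e_i)], over [i] first gives [q (f_j) = 1]. *)
Lemma tight_bound_trace n k (f : 'I_k -> V) a (e : 'I_n -> V) :
    (0 < k)%N -> (forall x y, ip (S x) y = ip x (S y)) ->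
    (forall j, q (f j) = 1) -> tight_frame conj re ip f a -> onb ip e ->
  a = k%:R / re (trace_wrt ip e (fun x => S (S x))).
Proof.
move=> k0 Ssym qf [_ _ tf] oe.
have tfE v : \sum_(j < k) A (ip v (f j)) = a * N v.
  have [] := tf v; rewrite (frame_sum_ord ip HK) !lee_fin => h1 h2.
  by apply: le_anti; rewrite h1 h2.
have trE : re (trace_wrt ip e (fun x => S (S x))) = \sum_(i < n) q (e i).
  by rewrite /trace_wrt (re_sum HK); apply: eq_bigr => i _; rewrite Ssym.
have main : k%:R = a * \sum_(i < n) q (e i).
  rewrite mulr_sumr; under eq_bigr do rewrite -tfE.
  rewrite exchange_big /=; under eq_bigr => j _.
    under eq_bigr do rewrite Ssym.
    rewrite (onb_parseval _ oe) qf; over.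
  by rewrite sumr_const card_ord.
rewrite trE main mulfK //; apply/eqP => Q0.
by move/eqP: main; rewrite Q0 mulr0 pnatr_eq0 -leqn0 leqNgt k0.
Qed.

End GramSchmidt.

(** * Compact operators and the essential norm *)

Section EssentialNorm.
Local Open Scope ring_scope.
Variables (R : realType) (K : fieldType).
Variables (conj : K -> K) (re : K -> R) (ofR : R -> K).
Variables (V : lmodType K) (ip : V -> V -> K).
Hypothesis HK : scalar_field conj re ofR.
Hypothesis HV : is_inner_product conj re ofR ip.

Local Notation N := (nrm2 re ip).
Local Notation norm := (nrm re ip).
Local Notation A := (abs2 conj re).
Local Notation orthoid := (orthoid ip).
Local Notation oproj := (oproj ip).
Local Notation compact := (compact_op re ip).

Lemma normalize x : x != 0 -> exists2 c, c != 0 & N (ofR c *: x) = 1.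
Proof.
move=> x0; have Nx : N x != 0 by apply: contra x0 => /eqP/(nrm2_eq0 HV) ->.
have Nx0 : 0 < N x by rewrite lt_neqAle eq_sym Nx (nrm2_ge0 HV).
exists (Num.sqrt (N x))^-1; first by rewrite invr_eq0 sqrtr_eq0 -ltNge.
by rewrite (nrm2_ofRZ HK HV) exprVn sqr_sqrtr ?ltW // mulVf.
Qed.

(** Discarding the zero vectors leaves a basis. *)
Lemma orthoid_span_dim e n : orthoid e n -> (forall x, oproj e n x = x) ->
  finite_dim V.
Proof.
move=> [o1 o2] span; pose s := [seq y <- mkseq e n | y != 0].
have orth i j : (i < size s)%N -> (j < size s)%N -> i != j -> ip s`_i s`_j = 0.
  have : pairwise (fun x y => ip x y == 0) s.
    apply: pairwise_filter; apply/(pairwiseP 0) => a b.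
    rewrite !inE size_mkseq => an bn ab; rewrite !nth_mkseq // o1 //.
    by rewrite ltn_eqF.
  move/(pairwiseP 0) => h i_s j_s; rewrite neq_ltn => /orP[ij|ji].
    exact/eqP/h.
  by apply: (ip_eq0C HK HV); exact/eqP/h.
exists (size s), (fun i => s`_i); split=> [c c0 i|x].
  have si : s`_i != 0.
    by have /(mem_nth 0) := ltn_ord i; rewrite mem_filter => /andP[].
  have := congr1 (ip^~ s`_i) c0; rewrite (ip0l HV) (ip_suml HV) (bigD1 i) //=.
  rewrite big1 => [|j ji]; last by rewrite (ipZl HV) orth ?mulr0.
  rewrite addr0 (ipZl HV) => /eqP; rewrite mulf_eq0 => /orP[/eqP//|/eqP h].
  by move: si; rewrite (nrm2_eq0 HV (x := s`_i)) ?eqxx // /nrm2 h (re0 HK).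
exists (fun i => ip x s`_i); rewrite -{1}(span x) /oproj.
transitivity (\sum_(y <- s) ip x y *: y); last by rewrite (big_nth 0) big_mkord.
rewrite big_filter [RHS]big_mkcond /= big_mkseq; apply: eq_bigr => i _.
by case: eqVneq => [->|//]; rewrite scaler0.
Qed.

Lemma orthoid_complement : ~ finite_dim V -> forall n e, orthoid e n ->
  exists x, (forall i, (i < n)%N -> ip x (e i) = 0) /\ N x = 1.
Proof.
move=> infd n e oe; apply: contrapT => nex; apply: infd.
apply: (orthoid_span_dim oe) => x; apply/eqP; rewrite eq_sym -subr_eq0.
apply: contrapT => /negP/normalize[c c0 Nc]; apply: nex.
exists (ofR c *: (x - oproj e n x)); split=> // i i_n.
by rewrite (ipZl HV) (ip_oproj0 HK HV oe) // mulr0.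
Qed.

Lemma compact_add C D : compact C -> compact D -> compact (fun x => C x + D x).
Proof.
move=> [linC cC] [linD cD]; split=> [a x y|u u1].
  by rewrite linC linD scalerDr addrACA.
have [phi [iphi [l cl]]] := cC u u1.
have [psi [ipsi [m cm]]] := cD (u \o phi) (fun n => u1 (phi n)).
exists (phi \o psi); split; first by move=> n; exact: (subseq_comp iphi ipsi).
exists (l + m) => e e0; have e2 : 0 < e / 2 by rewrite divr_gt0.
have [N1 h1] := cl _ e2; have [N2 h2] := cm _ e2.
exists (maxn N1 N2) => n; rewrite geq_max => /andP[n1 n2] /=.
rewrite opprD addrACA (le_lt_trans (nrmD HK HV _ _)) // [e]splitr ltrD //.
  by apply: h1; apply: leq_trans n1 (subseq_mono ipsi n).
exact: h2.
Qed.

Lemma compact_zero : compact (fun=> 0).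
Proof.
split=> [a x y|u _]; first by rewrite scaler0 addr0.
exists id; split=> //; exists 0 => e e0; exists 0%N => n _.
by rewrite subrr (nrm_0 HK HV).
Qed.

Lemma compact_sum (F : nat -> V -> V) n :
  (forall i, (i < n)%N -> compact (F i)) ->
  compact (fun x => \sum_(i < n) F i x).
Proof.
elim: n => [|n IH] cF.
  have -> : (fun x => \sum_(i < 0) F i x) = (fun=> 0).
    by apply/funext => x; rewrite big_ord0.
  exact: compact_zero.
have -> : (fun x => \sum_(i < n.+1) F i x) =
    (fun x => \sum_(i < n) F i x + F n x).
  by apply/funext => x; rewrite big_ord_recr.
by apply: compact_add; [apply: IH => i /ltnW|]; exact: cF.
Qed.

Lemma compact_rank_one (phi : V -> K) (M : R) w :
    (forall a x y, phi (a *: x + y) = a * phi x + phi y) ->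
    (forall x, norm x <= 1 -> A (phi x) <= M) ->
  compact (fun x => phi x *: w).
Proof.
move=> lin bnd; split=> [a x y|u u1]; first by rewrite lin scalerDl scalerA.
have [n|f incf [l hl]] := @scalar_bolzano_weierstrass _ _ _ _ _ HK (phi \o u) M.
  exact: bnd.
exists f; split=> //; exists (l *: w) => e e0.
(* Adding 1 keeps the divisor positive when [w = 0]. *)
have Nw : 0 < N w + 1 by rewrite ltr_wpDl // (nrm2_ge0 HV).
have [|n0 h] := hl (e ^+ 2 / (N w + 1)); first by rewrite divr_gt0 // exprn_gt0.
exists n0 => n /h; rewrite ltr_pdivlMr //= => lt.
rewrite -scalerBl (nrm_ltP HV) ?ltW // (nrm2Z HK HV) (le_lt_trans _ lt) //.
by rewrite ler_wpM2l ?(abs2_ge0 HK) // lerDl.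
Qed.

(** Vectors of the unit ball with images of norm above [n] would have no subsequence with convergent
    images. Boundedness ensures that the [sup] in [opnorm] is an actual upper bound. *)
Lemma compact_bounded C : compact C ->
  exists M, forall x, norm x <= 1 -> norm (C x) <= M.
Proof.
move=> [linC cC]; apply: contrapT => nex.
have /choice[u Hu] n : exists x, norm x <= 1 /\ n%:R < norm (C x).
  apply: contrapT => nx; apply: nex; exists n%:R => x x1.
  by rewrite leNgt; apply/negP => lt; apply: nx; exists x.
have [phi [iphi [l cl]]] := cC u (fun n => (Hu n).1).
have [n0 h] := cl 1 ltr01.
pose n := maxn n0 (Num.truncn (1 + norm l)).+1.
have := h n (leq_maxl _ _); apply/negP; rewrite -leNgt.
have le1 : 1 + norm l <= norm (C (u (phi n))).
  apply/ltW/(lt_trans _ (Hu (phi n)).2).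
  apply: (lt_le_trans (truncnS_gt _)); rewrite ler_nat.
  by apply: leq_trans (subseq_mono iphi n); exact: leq_maxr.
by have := nrmD HK HV (C (u (phi n)) - l) l; rewrite subrK; lra.
Qed.

Lemma opnorm_ge0 B : 0 <= opnorm re ip B.
Proof.
rewrite /opnorm; set E := (X in sup X).
(* A set without a supremum has [sup] equal to 0 by convention. *)
have [hs|nhs] := pselect (has_sup E); last by rewrite sup_out.
have [[y [x x1 _]] ub] := hs.
apply: (le_trans (nrm_ge0 re ip (B x))); apply: ub_le_sup ub _ _.
by exists x.
Qed.

Lemma opnorm_le B a : (forall x, norm x <= 1 -> norm (B x) <= a) ->
  opnorm re ip B <= a.
Proof.
move=> h; apply: ge_sup => [|_ [x x1 <-]]; last exact: h.
by exists (norm (B 0)); exists 0 => //=; rewrite (nrm_0 HK HV).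
Qed.

Lemma le_opnorm B M : (forall x, norm x <= 1 -> norm (B x) <= M) ->
  forall x, norm x <= 1 -> norm (B x) <= opnorm re ip B.
Proof.
move=> h x x1; apply: ub_le_sup; last by exists x.
by exists M => _ [y y1 <-]; exact: h.
Qed.

Lemma ess_norm_le B C : compact C ->
  ess_norm re ip B <= opnorm re ip (fun x => B x - C x).
Proof.
move=> cC; apply: ge_inf; last by exists C.
by exists 0 => _ [D _ <-]; exact: opnorm_ge0.
Qed.

Lemma orthonormal_sequence : ~ finite_dim V -> exists e : nat -> V,
  (forall i, N (e i) = 1) /\ (forall i j, i != j -> ip (e i) (e j) = 0).
Proof.
move=> infd.
have [//|_ n e oe|e [oe _ He]] :=
    @gram_schmidt _ _ _ _ _ _ _ HK HV 2 (fun=> 0) (fun=> True).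
  by have [x [x1 x2]] := orthoid_complement infd oe; exists x.
(* Only the odd indices, those not divisible by 2, are sure to carry unit vectors. *)
exists (fun i => e i.*2.+1); split=> [i|i j ij].
  by apply: (He _ _).1; rewrite dvdn2 /= odd_double.
apply: (oe (maxn i j).*2.+2).1; last by rewrite eqSS (inj_eq double_inj).
  by rewrite !ltnS leq_double leq_maxl.
by rewrite !ltnS leq_double leq_maxr.
Qed.

(* A compact C close to B would be bounded below, hence could not send an
   orthonormal sequence to one with a convergent subsequence. *)
Lemma ess_norm_ge B c M : ~ finite_dim V -> linear_op B ->
    (forall x, norm x <= 1 -> norm (B x) <= M) ->
    (forall x, c * norm x <= norm (B x)) ->
  c <= ess_norm re ip B.
Proof.
move=> infd linB bB cB; apply: lb_le_inf.
  exists (opnorm re ip (fun x => B x - 0)).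
  by exists (fun=> 0) => //; exact: compact_zero.
move=> _ [C cC <-]; have [linC seqC] := cC.
set eta := opnorm _ _ _; rewrite leNgt; apply/negP => lt.
have [MC hMC] := compact_bounded cC.
have le_eta x : norm x <= 1 -> norm (B x - C x) <= eta.
  apply: (@le_opnorm _ (M + MC)) => y y1.
  rewrite (le_trans (nrmD HK HV _ _)) // lerD ?bB //.
  by rewrite (nrmN HK HV) hMC.
have [e [e1 e0]] := orthonormal_sequence infd.
have en n : norm (e n) <= 1 by rewrite ((nrm_eq1 HV _).2 (e1 n)).
have [phi [iphi [l cl]]] := seqC e en.
have d0 : 0 < (c - eta) / 2 by rewrite divr_gt0 // subr_gt0.
have [n h] := cl _ d0.
have h1 := h n (leqnn n); have h2 := h n.+1 (leqnSn n).
(* For this unit vector [|C x| < c - eta] by convergence and [|B x - C x| <= eta], against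
   [|B x| >= c]. *)
pose r : R := (Num.sqrt 2)^-1; pose x := ofR r *: (e (phi n) - e (phi n.+1)).
have r0 : 0 <= r by rewrite invr_ge0 sqrtr_ge0.
have r2 : r ^+ 2 = 2^-1 by rewrite exprVn sqr_sqrtr.
have Nx : N x = 1.
  rewrite (nrm2_ofRZ HK HV) (nrm2D HK HV) (nrm2N HK HV) !e1 (ipNr HK HV) e0.
    by rewrite oppr0 (re0 HK) r2; field.
  by rewrite ltn_eqF.
have nx : norm x = 1 by apply/(nrm_eq1 HV).
have := le_eta x; rewrite nx => /(_ (lexx _)) leB.
have lB : c <= norm (B x) by have := cB x; rewrite nx mulr1.
have tri := nrmD HK HV (B x - C x) (C x); rewrite subrK in tri.
have lC : norm (C x) <= norm (C (e (phi n)) - C (e (phi n.+1))).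
  rewrite /x (linear_opZ linC) (linear_opB linC) (nrmZ HK HV) (abs2_ofR HK).
  rewrite ler_piMl ?(nrm_ge0 re ip) // -[leRHS]sqrtr1 ler_wsqrtr // r2; lra.
have tri2 := nrmD HK HV (C (e (phi n)) - l) (l - C (e (phi n.+1))).
rewrite addrA subrK [norm (l - _)](nrmBC HK HV) in tri2.
lra.
Qed.

Section Compression.
Variables (S : V -> V) (M : R).
Hypothesis linS : linear_op S.
Hypothesis bndS : forall x, norm (S x) <= M * norm x.
Hypothesis symS : forall x y, ip (S x) y = ip x (S y).
Local Notation q x := (N (S x)).

(** With [P] the projection and [Q = 1 - P], the operator is [S^2 - Q S^2 Q = S^2 P + P S^2 Q], a
    sum of rank-one maps whose coefficients are bounded by Bessel's inequality. *)
Lemma compression_compact e n : orthoid e n -> compact (fun x => S (S x) -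
  (S (S (x - oproj e n x)) - oproj e n (S (S (x - oproj e n x))))).
Proof.
move=> oe; pose Q x := x - oproj e n x.
have linQ : linear_op Q.
  move=> a x y; rewrite /Q (oproj_linear HV e n) scalerBr opprD.
  by rewrite addrACA.
have linP := oproj_linear HV e n.
have bndS2 x : N (S x) <= M ^+ 2 * N x.
  rewrite -!(nrm_sqr HV) -exprMn ler_pXn2r ?nnegrE ?nrm_ge0 //.
  exact: le_trans (nrm_ge0 _ _ (S x)) (bndS x).
have -> : (fun x => S (S x) - (S (S (x - oproj e n x)) -
      oproj e n (S (S (x - oproj e n x))))) =
    (fun x => \sum_(i < n) ip x (e i) *: S (S (e i)) +
      \sum_(i < n) ip (S (S (Q x))) (e i) *: e i).
  apply/funext => x; rewrite opprB addrCA addrC; congr (_ + _).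
  rewrite -(linear_opB linS) -(linear_opB linS) opprB addrCA subrr addr0.
  rewrite /oproj (linear_op_sum linS) (linear_op_sum linS).
  by apply: eq_bigr => i _; rewrite !(linear_opZ linS).
apply: compact_add.
  apply: (compact_sum (F := fun i x => ip x (e i) *: S (S (e i)))) => i i_n.
  apply: (@compact_rank_one _ 1) => [a x y|x]; first exact: (ipDZl HV).
  rewrite (nrm_leP HV) // expr1n; apply: le_trans.
  apply: le_trans (bessel HK HV oe x).
  rewrite (bigD1 (Ordinal i_n)) //= lerDl sumr_ge0 // => j _.
  exact: (abs2_ge0 HK).
apply: (compact_sum (F := fun i x => ip (S (S (Q x))) (e i) *: e i)) => i i_n.
apply: (@compact_rank_one _ (M ^+ 2 * M ^+ 2)) => [a x y|x].
  by rewrite linQ !linS (ipDZl HV).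
rewrite (nrm_leP HV) // expr1n => x1.
apply: (@le_trans _ _ (N (S (S (Q x))))).
  apply: le_trans (bessel HK HV oe _).
  rewrite (bigD1 (Ordinal i_n)) //= lerDl sumr_ge0 // => j _.
  exact: (abs2_ge0 HK).
rewrite (le_trans (bndS2 _)) // ler_wpM2l ?sqr_ge0 // (le_trans (bndS2 _)) //.
rewrite -[leRHS]mulr1 ler_wpM2l ?sqr_ge0 // (le_trans _ x1) //.
exact: (nrm2_subproj_le HK HV).
Qed.

Lemma ess_norm_big a e n : 0 <= a -> a < ess_norm re ip (fun x => S (S x)) ->
    orthoid e n ->
  exists x, [/\ forall i, (i < n)%N -> ip x (e i) = 0, N x = 1 & a <= q x].
Proof.
move=> a0 lt oe; apply: contrapT => nex.
have small x : (forall i, (i < n)%N -> ip x (e i) = 0) -> q x <= a * N x.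
  move=> xe; have [->|x0] := eqVneq x 0.
    by rewrite (linear_op0 linS) (nrm2_0 HK HV) mulr0.
  have [c c0 Nc] := normalize x0.
  have c2 : 0 < c ^+ 2 by rewrite lt_neqAle sqr_ge0 eq_sym expf_eq0 c0.
  rewrite -(ler_pM2l c2) -(q_ofRZ HK HV linS) mulrCA -(nrm2_ofRZ HK HV) Nc.
  rewrite mulr1.
  rewrite leNgt; apply/negP => /ltW le; apply: nex; exists (ofR c *: x).
  by split=> // i i_n; rewrite (ipZl HV) xe ?mulr0.
move: lt; apply/negP; rewrite -leNgt.
apply: (le_trans (ess_norm_le _ (compression_compact oe))).
apply: opnorm_le => x; rewrite !(nrm_leP HV) // expr1n => x1.
rewrite opprB addrCA subrr addr0.
set y := x - oproj e n x; set w := _ - _.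
have we i : (i < n)%N -> ip w (e i) = 0 by exact: (ip_oproj0 HK HV oe).
have ye i : (i < n)%N -> ip y (e i) = 0 by exact: (ip_oproj0 HK HV oe).
have Ny : N y <= 1 by apply: le_trans x1; exact: (nrm2_subproj_le HK HV).
(* [w] is the component of [S (S y)] orthogonal to the [e i], so [<w, w> = <S (S y), w>], and
   symmetry moves one [S] across. *)
have Nw : N w = re (ip (S y) (S w)).
  rewrite -symS /nrm2 {1}/w (ipBl HV).
  rewrite [ip (oproj e n _) w](ip_eq0C HK HV) ?subr0 //.
  exact: (ip_subproj HK HV).
have := cauchy_schwarz HK HV (S y) (S w); rewrite -Nw => cs.
(* Both [y] and [w] lie in the complement, so [q y <= a] and [q w <= a * N w]. *)
have le2 : N w ^+ 2 <= a ^+ 2 * N w.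
  apply: (le_trans cs); rewrite expr2 -mulrA.
  apply: ler_pM; rewrite ?(nrm2_ge0 HV) ?small //.
  by apply: le_trans (small _ ye) _; rewrite -[leRHS]mulr1 ler_wpM2l.
have [w0|w0] := eqVneq (N w) 0; first by rewrite w0 sqr_ge0.
have Nw0 : 0 < N w by rewrite lt_neqAle eq_sym w0 (nrm2_ge0 HV).
by rewrite -(ler_pM2r Nw0) -expr2.
Qed.

End Compression.

End EssentialNorm.

(** * Assembly of the three claims over an abstract scalar field *)

Section Theorem3.
Local Open Scope classical_set_scope.
Local Open Scope ring_scope.
Variables (R : realType) (K : fieldType).
Variables (conj : K -> K) (re : K -> R) (ofR : R -> K).
Hypothesis HK : scalar_field conj re ofR.

Lemma theorem3_scalar_field : theorem3_for conj re ofR.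
Proof.
move=> V ip [HV _ sepV] T [[linT [M0 bndT0]] [S HS]].
have [bndS TK SK] := HS; have linS := bndS.1.
pose q x := nrm2 re ip (S x).
have ell y : ellipsoid re ip T y <-> q y = 1.
  split=> [[x x1 <-]|qy]; first by rewrite /q TK; apply/(nrm_eq1 HV).
  by exists (S y); [apply/(nrm_eq1 HV)|rewrite SK].
(* Adding 1 makes the bound strictly positive, so that [M ^+ 2] can be inverted. *)
pose M := `|M0| + 1; have Mgt0 : 0 < M by rewrite ltr_wpDl.
have bndT x : nrm re ip (T x) <= M * nrm re ip x.
  apply: (le_trans (bndT0 x)); apply: ler_wpM2r; first exact: nrm_ge0.
  by rewrite (le_trans (ler_norm _)) // lerDl.
have lowS x : nrm re ip x <= M * nrm re ip (S x) by rewrite -{1}(SK x).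
have q_eq0 x : q x = 0 -> x = 0.
  move/(nrm2_eq0 HV) => Sx; apply: (can_inj SK); rewrite Sx.
  by rewrite (linear_op0 linS).
have fin_exists n k : (0 < n)%N -> has_dim V n -> (n <= k)%N ->
    exists (f : 'I_k -> V) (A : R),
      (forall j, ellipsoid re ip T (f j)) /\ tight_frame conj re ip f A.
  move=> n0 dimn nk.
  have [f [a [qf tf]]] := tight_finite_exists HK HV linS dimn n0 nk q_eq0.
  by exists f, a; split=> // j; exact/ell/qf.
split; [|split].
- have [[n dimn]|infd] := pselect (finite_dim V).
    have [n0|n0] := posnP n; last first.
      have [f [a fa]] := fin_exists n n n0 dimn (leqnn n).
      by exists 'I_n, f, a.
    (* In dimension 0 the unit sphere is empty; the empty family is tight, both sides of the frame
       inequalities being 0. *)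
    have V0 (x : V) : x = 0.
      by move: dimn; rewrite n0 => -[b [_ /(_ x)[c ->]]]; rewrite big_ord0.
    exists 'I_0, (fun=> 0), 1; split; first by case.
    split=> // x; rewrite (frame_sum_ord ip HK) big_ord0 (V0 x).
    by rewrite (nrm2_0 HK HV) mulr0 lexx.
  (* Unit vectors satisfy [q x >= 1 / M^2], so this bound gives [k * q x >= 2 = 1 + d] with
     [d = 1]. *)
  have k0 : 0 < 2 * M ^+ 2 by rewrite mulr_gt0 // exprn_gt0.
  have [n e oe|f [tf qf]] := tight_seq_exists HK HV linS k0 ltr01 sepV.
    have [x [xe x1]] := orthoid_complement HK HV infd oe.
    exists x; split=> //; have nx : nrm re ip x = 1 by apply/(nrm_eq1 HV).
    have := lowS x; rewrite nx -(nrm_sqr HV) => h.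
    have : 1 ^+ 2 <= (M * nrm re ip (S x)) ^+ 2.
      by rewrite ler_pXn2r ?nnegrE ?ler01 // (le_trans ler01).
    by rewrite expr1n exprMn; lra.
  exists nat, f, (2 * M ^+ 2); split; first by move=> j; exact/ell/qf.
  exact: (tight_seq_frame HK k0 tf).
- move=> n n0 dimn; split; first by move=> k; exact: fin_exists.
  (* The inverse [Q] of [P] inherits symmetry, and equality of the ellipsoids puts each [f j] on the
     level set 1 of [|Q y|^2]. *)
  move=> P Q [_ symP _] [[linQ _] PK QK] ellP k nk f a ellf tf e onbe.
  apply: (tight_bound_trace HK HV _ _ _ tf onbe).
  + exact: leq_trans n0 nk.
  + by move=> x y; rewrite -{1}(QK y) -symP QK.
  move=> j; have := ellf j; rewrite -ellP => -[x x1 <-]; rewrite PK.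
  exact/(nrm_eq1 HV).
move=> infd [_ symT _] S' [[linS' [M' bndS']] TK' SK'] k.
have -> : S' = S by apply/funext => x; rewrite -{1}(SK x) TK'.
have bS x : nrm re ip (S x) <= M' * nrm re ip x.
  by have := bndS' x; rewrite -{1}(SK x) TK'.
have symS x y : ip (S x) y = ip x (S y) by rewrite -{1}(SK y) -symT SK.
set ess := ess_norm _ _ _ => ltk.
have M20 : 0 < (M ^+ 2)^-1 by rewrite invr_gt0 exprn_gt0.
(* [|S (S x)| >= |x| / M^2] bounds the essential norm below, so [1 / ess < k] can be read as
   [1 < k * ess]. *)
have ess0 : 0 < ess.
  apply: (lt_le_trans M20).
  apply: (@ess_norm_ge _ _ _ _ _ _ _ HK HV _ _ (`|M'| * `|M'|)) => //.
  + by move=> a x y; rewrite !linS.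
  + have bS1 x : nrm re ip (S x) <= `|M'| * nrm re ip x.
      by apply: (le_trans (bS x)); rewrite ler_wpM2r ?ler_norm // nrm_ge0.
    move=> x x1; rewrite (le_trans (bS1 _)) // ler_wpM2l //.
    by rewrite (le_trans (bS1 _)) // -[leRHS]mulr1 ler_wpM2l.
  move=> x; rewrite mulrC ler_pdivrMr ?exprn_gt0 // mulrC expr2 -mulrA.
  by rewrite (le_trans (lowS x)) // ler_pM2l.
have k0 : 0 < k by apply: lt_trans ltk; rewrite divr_gt0.
rewrite ltr_pdivrMr // in ltk.
(* Half of the gap, so that [(1 + d) / k] is still below [ess]. *)
pose d := (k * ess - 1) / 2.
have d0 : 0 < d by rewrite divr_gt0 // subr_gt0.
have [n e oe|f [tf qf]] := tight_seq_exists HK HV linS k0 d0 sepV.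
  have a0 : 0 <= (1 + d) / k by rewrite divr_ge0 ?(ltW k0) // addr_ge0 // ltW.
  have lta : (1 + d) / k < ess by rewrite ltr_pdivrMr // [ess * k]mulrC /d; lra.
  have [x [xe x1 qx]] := ess_norm_big HK HV linS bS symS a0 lta oe.
  by exists x; split=> //; move: qx; rewrite ler_pdivrMr // [_ * k]mulrC.
exists nat, f; split; first by move=> j; exact/ell/qf.
exact: (tight_seq_frame HK k0 tf).
Qed.

End Theorem3.

(* Real case (K = R, conj = id) and complex case (K = R[i]). *)
Theorem theorem3 (R : realType) :
  theorem3_for (K := R) id id id /\
  theorem3_for (K := R[i]) (@conjc R) (@Re R) (fun r => Complex r 0%R).
Proof.
split; apply: theorem3_scalar_field.
- exact: real_scalar_field.
- exact: complex_scalar_field.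
Qed.
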